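(* Let $n_1,n_2\in\mathbb{R}^+\cup\{0\}$, $g\in D_{HK}$ and $f=\mathcal{J}_a^{n_1+n_2}g$. Then $\mathcal{D}_a^{n_1}\mathcal{D}_a^{n_2}f=\mathcal{D}_a^{n_1+n_2}f$.
   Context: Fix real numbers $a<b$. $D$ denotes the distributional derivative on $(a,b)$, $D^m$ its $m$-fold iterate. Let $C_0=\{F\in C[a,b]:F(a)=0\}$. A distribution $f$ on $(a,b)$ is Henstock–Kurzweil integrable if $f=DF$ for some (unique) $F\in C_0$; $\int_c^d f=F(d)-F(c)$. $D_{HK}$ is the space of these with the Alexiewicz norm $\|f\|_A=\sup_{[a,b]}|F|$; $L^1[a,b]$ is dense in it. Riemann–Liouville fractional integral on $D_{HK}$: for $n\ge1$, $\mathcal{J}_a^nf(x)=\frac{1}{\Gamma(n)}\int_a^x(x-t)^{n-1}f(t)\,dt$; for $0<n<1$, $\mathcal{J}_a^nf(x)=\frac{1}{\Gamma(n)}\lim_{k}\int_a^x(x-t)^{n-1}f_k(t)\,dt$ with $(f_k)\subset L^1[a,b]$, $\|f_k-f\|_A\to0$; $\mathcal{J}_a^0=I$; these map $D_{HK}$ into $D_{HK}$. Riemann–Liouville fractional derivative: for $n\ge0$, $m=\lceil n\rceil$, $\mathcal{D}_a^nf=D^m\mathcal{J}_a^{m-n}f$, $\mathcal{D}_a^0=I$. *)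

(* Defs.v *)
From HB Require Import structures.
From mathcomp Require Import all_boot all_order all_algebra.
From mathcomp Require Import all_classical all_reals all_analysis.
Set Implicit Arguments. Unset Strict Implicit. Unset Printing Implicit Defensive.
Import Order.TTheory GRing.Theory Num.Theory.
Import numFieldNormedType.Exports.
Local Open Scope classical_set_scope.
Local Open Scope ring_scope.

Section HKfrac.
Context {R : realType}.
Local Notation mu := (@lebesgue_measure R).

Definition Gamma (s : R) : R :=
  \int[mu]_(t in `]0, +oo[) (t `^ (s - 1) * expR (- t)).

Variables a b : R.

Definition test_fun (phi : R -> R) : Prop :=
  (forall (k : nat) (x : R), derivable (iter k (fun f : R -> R => derive1 f) phi) x 1) /\
  exists c d : R, [/\ a < c, d < b &
    forall x, x < c \/ d < x -> phi x = 0].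

(** Distributions on (a,b), viewed as functionals on test functions;
    two distributions are equal when they agree on all test functions. *)
Definition distr := (R -> R) -> R.
Definition deq (T1 T2 : distr) : Prop :=
  forall phi, test_fun phi -> T1 phi = T2 phi.

Definition regd (F : R -> R) : distr :=
  fun phi => \int[mu]_(x in `]a, b[) (F x * phi x).

Definition Dd (T : distr) : distr := fun phi => - T (derive1 phi).
Definition Dn (m : nat) (T : distr) : distr := iter m Dd T.

Definition C0 (F : R -> R) : Prop := {within `[a, b], continuous F} /\ F a = 0.
Definition primitive_of (F : R -> R) (f : distr) : Prop :=
  C0 F /\ deq (Dd (regd F)) f.

Definition HK (f : distr) : Prop := exists F, primitive_of F f.

Definition prim (f : distr) : R -> R := xget (fun _ => 0) (fun F => primitive_of F f).

(** HK integral of f * h over [a,x] for h of bounded variation (here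
    absolutely continuous): F h |_a^x - \int_a^x F dh. *)
Definition HKmul (x : R) (f : distr) (h : R -> R) : R :=
  prim f x * h x - prim f a * h a - \int[mu]_(t in `[a, x]) (prim f t * derive1 h t).

Definition L1 (g : R -> R) : Prop := mu.-integrable `[a, b] (EFin \o g).

Definition alex_cvg (u : nat -> distr) (v : distr) : Prop :=
  exists (U : nat -> R -> R) (V : R -> R),
    [/\ forall k, primitive_of (U k) (u k), primitive_of V v &
      forall e : R, 0 < e -> exists N : nat, forall k : nat, (N <= k)%N ->
        forall x, a <= x <= b -> `|U k x - V x| <= e].

(** Riemann--Liouville fractional integral on D_HK
    (argument n < 0 is never used; it returns f). *)
Definition RLint (n : R) (f : distr) : distr :=
  if n <= 0 then f
  else if 1 <= n then
    regd (fun x => (Gamma n)^-1 * HKmul x f (fun t => (x - t) `^ (n - 1)))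
  else
    xget (fun _ => 0) (fun h : distr => HK h /\
      forall fk : nat -> R -> R, (forall k, L1 (fk k)) ->
        alex_cvg (fun k => regd (fk k)) f ->
        alex_cvg (fun k => regd (fun x =>
            (Gamma n)^-1 * \int[mu]_(t in `[a, x]) ((x - t) `^ (n - 1) * fk k t))) h).

Definition RLder (n : R) (f : distr) : distr :=
  let m := `|Num.ceil n|%N in Dn m (RLint (m%:R - n) f).

End HKfrac.

(* Main.v *)
(* The fractional integral of order p of a distribution f = DF, F in C_0, has the
   primitive J^p F(x) = 1/Gamma(p) \int_a^x (x-t)^(p-1) F(t) dt, and F is determined
   by f (du Bois-Reymond).  For p < 1, where the integral is defined by L^1
   approximation, this rests on J^1 J^p h = J^p J^1 h for h in L^1 and on the
   continuity of J^p in the sup norm.  The semigroup law J^p J^q = J^(p+q) is Fubini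
   together with Gamma(p) Gamma(q) = B(p,q) Gamma(p+q).  If f has primitive
   J^(p+q) F, then its fractional derivative of order p is D^m applied to a
   distribution with primitive J^(m+q) F, and therefore has primitive J^q F.
   Starting from f = J^(n1+n2) g, both sides of the identity have the primitive
   of g. *)
Require Import Defs.
From HB Require Import structures.
From mathcomp Require Import all_boot all_order all_algebra.
From mathcomp Require Import all_classical all_reals all_analysis.
From mathcomp Require Import measurable_realfun ring lra.
Set Implicit Arguments. Unset Strict Implicit. Unset Printing Implicit Defensive.
Import Order.TTheory GRing.Theory Num.Theory.
Import numFieldNormedType.Exports.
Local Open Scope ring_scope.

(** Distributions are compared only through [deq], and [prim] as well as [RLint] for orders below 1
    are choices made by [xget], so the identities of the overview cannot be expected as equalities
    of functionals. Every step is therefore phrased as [primitive_of] with an explicit continuous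
    function. For orders below 1 the choice must be pinned down twice: a limit exists by sup-norm
    continuity, and it is determined only because an approximating L^1 sequence exists; otherwise
    its defining condition would be vacuous. Real integrals are total, with value 0 where they
    diverge, and J^p of an L^1 function may diverge at some points when p < 1. Hence convolutions
    run over the whole line with a kernel vanishing on the nonpositive half-line, nonnegative
    integrals go through Tonelli in the extended reals, and Fubini is justified by convergence at
    order p + q. The Beta integral is not evaluated in general: scaling shows that a convolution of
    powers is a multiple of a power, and [eGammaM] identifies the multiple. *)

(** * Affine changes of variable and scalar factors in Lebesgue integrals *)

Section lebesgue.
Local Open Scope classical_set_scope.
Context {R : realType}.
Local Notation mu := (@lebesgue_measure R).

Lemma measurable_affine (c d : R) :
  measurable_fun [set: R] (fun x : R => c * x + d).
Proof. by apply: measurable_funD => //; exact: measurable_funM. Qed.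

Lemma ocitv_affine (c d u v : R) : c != 0 ->
  (mu `]u, v]%classic =
   `|c|%:E * mu ((fun x : R => (c * x + d)%R) @^-1` `]u, v]%classic))%E.
Proof.
move=> c0.
have [c_gt0|c_lt0|c00] := ltgtP 0 c; last by rewrite c00 eqxx in c0.
- have -> : (fun x : R => c * x + d) @^-1` `]u, v]%classic =
     `](u - d) / c, (v - d) / c]%classic.
    apply/seteqP; split => x /=; rewrite !in_itv/=;
      by rewrite ltr_pdivrMr// ler_pdivlMr// ltrBlDr lerBrDr [x * c]mulrC.
  rewrite !lebesgue_measure_itv/= !lte_fin.
  rewrite ltr_pM2r ?invr_gt0// ltrD2r.
  case: ifPn => uv; last by rewrite mule0.
  rewrite gtr0_norm// -!EFinB -EFinM; congr (_%:E).
  by rewrite -mulrBl mulrC mulfVK//; ring.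
- have -> : (fun x : R => c * x + d) @^-1` `]u, v]%classic =
     `[(v - d) / c, (u - d) / c[%classic.
    apply/seteqP; split => x /=; rewrite !in_itv/=;
      rewrite ler_ndivrMr// ltr_ndivlMr// ltrBlDr lerBrDr [x * c]mulrC;
      by rewrite andbC.
  rewrite !lebesgue_measure_itv/= !lte_fin.
  rewrite ltr_nM2r ?invr_lt0// ltrD2r.
  case: ifPn => uv; last by rewrite mule0.
  rewrite ltr0_norm// -!EFinB -EFinM; congr (_%:E).
  by rewrite -mulrBl mulNr mulrC mulfVK//; ring.
Qed.

(** The rescaled pushforward of [mu] agrees with [mu] on half-open intervals, which determine
    Lebesgue measure. *)
Lemma lebesgue_measure_affine (c d : R) (A : set R) : c != 0 -> measurable A ->
  (mu A = `|c|%:E * mu ((fun x : R => (c * x + d)%R) @^-1` A))%E.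
Proof.
move=> c0 mA.
pose phi : measurableTypeR R -> measurableTypeR R := fun x => c * x + d.
have mphi : measurable_fun setT phi by exact: measurable_affine.
pose m : {measure set (measurableTypeR R) -> \bar R} :=
  mscale (NngNum (normr_ge0 c)) (pushforward mu phi).
rewrite (@lebesgue_measure_unique _ (m mphi))// => _ [[u v] _ <-] /=.
exact: ocitv_affine.
Qed.

Lemma ge0_integral_affine (c d : R) (f : R -> \bar R) : c != 0 ->
  measurable_fun setT f -> (forall x, 0 <= f x)%E ->
  (\int[mu]_x f x = `|c|%:E * \int[mu]_x f (c * x + d)%R)%E.
Proof.
move=> c0 mf f0.
pose phi : measurableTypeR R -> measurableTypeR R := fun x => c * x + d.
have mphi : measurable_fun setT phi by exact: measurable_affine.
rewrite (eq_measure_integral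
  (mscale (NngNum (normr_ge0 c)) (pushforward mu phi))); last first.
  by move=> A mA _; exact: lebesgue_measure_affine.
rewrite ge0_integral_mscale//= ge0_integral_pushforward//=.
Qed.

(** The positive and negative parts each transform with factor 1, so divergent integrals are covered
    too. It serves for the translations and for the reflection [t -> x - t] of convolutions. *)
Lemma integral_isometry (c d : R) (f : R -> \bar R) : `|c| = 1 ->
  measurable_fun setT f ->
  (\int[mu]_x f x = \int[mu]_x f (c * x + d)%R)%E.
Proof.
move=> c1 mf.
have c0 : c != 0 by rewrite -normr_gt0 c1.
rewrite [LHS]integralE [RHS]integralE.
rewrite (@ge0_integral_affine c d f^\+%E)//; last exact: measurable_funepos.
rewrite (@ge0_integral_affine c d f^\-%E)//; last exact: measurable_funeneg.
rewrite c1 !mul1e.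
congr (_ - _)%E; apply: eq_integral => x _.
  by rewrite !funeposE.
by rewrite !funenegE.
Qed.

(** The constant is extended real because [eGamma] and [eBeta] are pulled out of integrals before
    they are known to be finite. *)
Lemma ge0_integral_EFinZl (k : \bar R) (f : R -> R) : measurable_fun setT f ->
  (forall x, 0 <= f x) -> (0 <= k)%E ->
  (\int[mu]_x (k * (f x)%:E) = k * \int[mu]_x (f x)%:E)%E.
Proof.
move=> mf f0 k0; apply: ge0_integralZl => //; first exact/measurable_EFinP.
by move=> x _; rewrite lee_fin.
Qed.

Lemma integral_gt0 (D : set R) (f : R -> \bar R) : measurable D ->
  mu D != 0%E -> measurable_fun D f -> (forall x, D x -> 0 < f x)%E ->
  (0 < \int[mu]_(x in D) f x)%E.
Proof.
move=> mD D0 mf f0.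
rewrite lt0e integral_ge0 ?andbT; last by move=> x /f0/ltW.
apply/eqP => I0; move/eqP : D0; apply.
have /ae_eq_integral_abs : (\int[mu]_(x in D) `|f x| = 0)%E.
  rewrite -I0; apply: eq_integral => x /set_mem Dx.
  by rewrite gee0_abs// ltW// f0.
move=> /(_ mD mf) [N [mN N0 sub]].
apply/eqP; rewrite -measure_le0 -N0 le_measure ?inE// => x Dx.
apply: sub => /= /(_ Dx) fx0; have := f0 x Dx; by rewrite fx0 ltxx.
Qed.

(* No integrability is assumed: a divergent integral has the junk real value 0 on
   both sides.  The same holds for [RintegralN_measurable]. *)
Lemma Rintegral_gt0Zl (D : set R) (c : R) (f : R -> R) : 0 < c ->
  measurable D -> measurable_fun D f ->
  \int[mu]_(t in D) (c * f t) = c * \int[mu]_(t in D) f t.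
Proof.
move=> c0 mD mf; rewrite /Rintegral.
have -> : (\int[mu]_(t in D) (c * f t)%:E = c%:E * \int[mu]_(t in D) (f t)%:E)%E.
  have mfE : measurable_fun D (EFin \o f) by exact/measurable_EFinP.
  rewrite integralE [X in (_ * X)%E]integralE.
  have -> : (\int[mu]_(t in D) (fun x => (c * f x)%:E)^\+ t =
      c%:E * \int[mu]_(t in D) (EFin \o f)^\+ t)%E.
    rewrite -ge0_integralZl//; last 2 first.
    - exact: measurable_funepos.
    - by rewrite lee_fin ltW.
    apply: eq_integral => t _; rewrite !funeposE /= EFinM.
    by rewrite maxeMr ?mule0// ltW.
  have -> : (\int[mu]_(t in D) (fun x => (c * f x)%:E)^\- t =
      c%:E * \int[mu]_(t in D) (EFin \o f)^\- t)%E.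
    rewrite -ge0_integralZl//; last 2 first.
    - exact: measurable_funeneg.
    - by rewrite lee_fin ltW.
    by apply: eq_integral => t _; rewrite !funenegE /= -mulrN EFinM maxeMr ?mule0// ltW.
  have cB (A B : \bar R) : (c%:E * A - c%:E * B = c%:E * (A - B))%E.
    by move: A B => [r||] [s||]; rewrite ?gt0_muley ?gt0_muleNy ?lte_fin//=;
      rewrite ?gt0_muley ?gt0_muleNy ?lte_fin//= -!EFinM -EFinB mulrBr.
  exact: cB.
case: (\int[mu]_(t in D) (f t)%:E)%E => [r||] //=.
- by rewrite gt0_muley ?lte_fin//= mulr0.
- by rewrite gt0_muleNy ?lte_fin//= mulr0.
Qed.

Lemma RintegralN_measurable (D : set R) (f : R -> R) : measurable D ->
  measurable_fun D f ->
  \int[mu]_(t in D) (- f t) = - \int[mu]_(t in D) f t.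
Proof.
move=> mD mf; rewrite /Rintegral integralE [in RHS]integralE.
have -> : (\int[mu]_(t in D) (fun t => (- f t)%:E)^\+ t =
    \int[mu]_(t in D) (EFin \o f)^\- t)%E.
  by apply: eq_integral => t _; rewrite funeposE funenegE.
have -> : (\int[mu]_(t in D) (fun t => (- f t)%:E)^\- t =
    \int[mu]_(t in D) (EFin \o f)^\+ t)%E.
  by apply: eq_integral => t _; rewrite funeposE funenegE /= opprK.
have fineN (A B : \bar R) : fine (B - A)%E = - fine (A - B)%E.
  by move: A B => [r||] [s||] //=; rewrite ?oppr0// opprB.
exact: fineN.
Qed.

End lebesgue.

(** * Gamma and Beta integrals *)

Section gamma.
Local Open Scope classical_set_scope.
Context {R : realType}.
Local Notation mu := (@lebesgue_measure R).
Implicit Types p q x t u : R.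

(** Truncating the power at 0 turns integrals over []0, x[] into convolutions on the whole line. *)
Definition pospow p u : R := if 0 < u then u `^ (p - 1) else 0.

Lemma pospow_ge0 p u : 0 <= pospow p u.
Proof. by rewrite /pospow; case: ifP => // _; exact: powR_ge0. Qed.

Lemma measurable_pospow p : measurable_fun setT (pospow p).
Proof.
apply: measurable_fun_ifT => //=.
exact: measurable_fun_ltr.
Qed.

Lemma pospowM p x u : 0 < x -> pospow p (x * u) = x `^ (p - 1) * pospow p u.
Proof.
move=> x0; rewrite /pospow pmulr_rgt0//; case: ifPn => u0; last by rewrite mulr0.
by rewrite powRM// ltW.
Qed.

Definition eGamma p : \bar R := (\int[mu]_u (pospow p u * expR (- u))%:E)%E.
Definition eBeta p q : \bar R :=
  (\int[mu]_u (pospow p (1 - u) * pospow q u)%:E)%E.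

Lemma eGamma_ge0 p : (0 <= eGamma p)%E.
Proof.
by apply: integral_ge0 => u _; rewrite lee_fin mulr_ge0 ?pospow_ge0 ?expR_ge0.
Qed.

Lemma eBeta_ge0 p q : (0 <= eBeta p q)%E.
Proof. by apply: integral_ge0 => u _; rewrite lee_fin mulr_ge0 ?pospow_ge0. Qed.

Lemma GammaE p : Gamma p = fine (eGamma p).
Proof.
rewrite /Gamma /Rintegral integral_mkcond; congr fine.
apply: eq_integral => u _; rewrite patchE /pospow /= mem_setE in_itv/= andbT.
by case: ifP => // _; rewrite mul0r.
Qed.

Lemma measurable_pospow_expR p :
  measurable_fun setT (fun u => pospow p u * expR (- u)).
Proof.
apply: measurable_funM; first exact: measurable_pospow.
exact: measurableT_comp.
Qed.

Lemma pospow_expR_ge0 p u : 0 <= pospow p u * expR (- u).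
Proof. by rewrite mulr_ge0 ?pospow_ge0 ?expR_ge0. Qed.

Lemma pospow_beta_ge0 p q x u : 0 <= pospow p (x - u) * pospow q u.
Proof. by rewrite mulr_ge0 ?pospow_ge0. Qed.

Lemma measurable_pospow_beta p q x :
  measurable_fun setT (fun u => pospow p (x - u) * pospow q u).
Proof.
apply: measurable_funM; last exact: measurable_pospow.
apply: measurableT_comp; first exact: measurable_pospow.
exact: measurable_funB.
Qed.

(** For positive x, substituting x u for u extracts the powers p - 1, q - 1 and 1 of x, whose
    exponents add up to p + q - 1. For nonpositive x the supports of the two factors are
    disjoint. *)
Lemma pospow_conv p q x :
  (\int[mu]_u (pospow p (x - u) * pospow q u)%:E =
   (pospow (p + q) x)%:E * eBeta p q)%E.
Proof.
have [x0|x0] := ltP 0 x; last first.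
  rewrite /pospow ltNge x0/= mul0e.
  apply: integral0_eq => u _; case: ifP => [xu|_]; last by rewrite mul0r.
  case: ifP => [u0|_]; last by rewrite mulr0.
  by move: xu; rewrite subr_gt0 => /(lt_trans u0); rewrite ltNge x0.
have mB : measurable_fun setT (fun u => (pospow p (x - u) * pospow q u)%:E).
  by apply/measurable_EFinP; exact: measurable_pospow_beta.
have B0 u : (0 <= (pospow p (x - u) * pospow q u)%:E)%E.
  by rewrite lee_fin pospow_beta_ge0.
have -> := ge0_integral_affine 0 (lt0r_neq0 x0) mB B0.
have E u : (pospow p (x - (x * u + 0)) * pospow q (x * u + 0))%:E =
  ((x `^ (p - 1) * x `^ (q - 1))%:E * (pospow p (1 - u) * pospow q u)%:E)%E.
  rewrite -EFinM addr0 (_ : x - x * u = x * (1 - u)); last by ring.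
  by rewrite !pospowM//; congr (_%:E); ring.
under eq_integral do rewrite E.
rewrite ge0_integral_EFinZl; last 3 first.
- exact: measurable_pospow_beta.
- exact: pospow_beta_ge0.
- by rewrite lee_fin mulr_ge0// powR_ge0.
rewrite muleA -EFinM; congr (_%:E * _)%E.
rewrite /pospow x0 gtr0_norm// (_ : p + q - 1 = 1 + ((p - 1) + (q - 1))); last by ring.
rewrite !powRD ?(gt_eqF x0)/= ?implybT// powRr1 1?ltW//.
Qed.

(* Tonelli, applied to [e^-x (x - y)^(p-1) y^(q-1)] on [0 < y < x]; it also yields
   finiteness of Gamma, without any estimate at infinity beyond [eGamma1]. *)
Lemma eGammaM p q : (eGamma p * eGamma q = eBeta p q * eGamma (p + q))%E.
Proof.
pose h (z : R * R) := ((pospow p (z.1 - z.2) * pospow q z.2) * expR (- z.1))%:E.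
have mh : measurable_fun setT h.
  apply/measurable_EFinP; apply: measurable_funM; last first.
    apply: measurableT_comp => //; apply: measurableT_comp => //.
  apply: measurable_funM.
    apply: measurableT_comp; first exact: measurable_pospow.
    exact: measurable_funB.
  by apply: measurableT_comp => //; exact: measurable_pospow.
have h0 z : (0 <= h z)%E.
  by rewrite lee_fin !mulr_ge0 ?pospow_ge0 ?expR_ge0.
have := @fubini_tonelli _ _ _ _ _ mu mu h mh h0.
rewrite /fubini_F /fubini_G /= => H.
transitivity (\int[mu]_y \int[mu]_x h (x, y))%E.
  rewrite [X in (_ * X)%E]/eGamma -ge0_integral_EFinZl; last 3 first.
  - exact: measurable_pospow_expR.
  - exact: pospow_expR_ge0.
  - exact: eGamma_ge0.
  apply: eq_integral => y _.
  have mhy : measurable_fun setT (fun x => h (x, y)) by exact: measurableT_comp.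
  have -> := integral_isometry y (normr1 R) mhy.
  rewrite muleC {1}/eGamma -ge0_integral_EFinZl; last 3 first.
  - exact: measurable_pospow_expR.
  - exact: pospow_expR_ge0.
  - by rewrite lee_fin pospow_expR_ge0.
  apply: eq_integral => u _; rewrite /h/= mul1r addrK -EFinM; congr (_%:E).
  by rewrite opprD expRD; ring.
rewrite -H [X in _ = (_ * X)%E]/eGamma -ge0_integral_EFinZl; last 3 first.
- exact: measurable_pospow_expR.
- exact: pospow_expR_ge0.
- exact: eBeta_ge0.
apply: eq_integral => x _.
rewrite EFinM muleA [(eBeta p q * _)%E]muleC -pospow_conv muleC.
rewrite -ge0_integral_EFinZl; last 3 first.
- exact: measurable_pospow_beta.
- exact: pospow_beta_ge0.
- by rewrite lee_fin expR_ge0.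
by apply: eq_integral => u _; rewrite -EFinM mulrC.
Qed.

Lemma eGamma1 : eGamma 1 = 1%E.
Proof.
rewrite -(@integral_exponential_pdf R 1) ?ltr01//.
rewrite /exponential_pdf /eGamma.
under [RHS]eq_integral => x _ do
  rewrite -[X in X%:E]/((_ \_ _) x) -[_%:E]/((EFin \o _ \_ _) x) -restrict_EFin.
rewrite -integral_mkcond -integral_itv_obnd_cbnd; last first.
  apply/measurable_EFinP; apply: measurable_funTS; apply: measurable_funM => //.
  apply: measurableT_comp => //; exact: measurable_funM.
rewrite [RHS]integral_mkcond; apply: eq_integral => u _.
rewrite patchE /pospow mem_setE in_itv/= andbT subrr.
by case: ifP => // u0; rewrite ?mul0r// powRr0 mulN1r.
Qed.

(** The lower limit stays positive to keep the fundamental theorem of calculus away from the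
    singularity at 0. *)
Lemma integral_powR p (e : R) : 0 < p -> 0 < e -> e < 1 ->
  (\int[mu]_(u in `[e, 1%R]) (u `^ (p - 1))%:E = (p^-1 - p^-1 * e `^ p)%:E)%E.
Proof.
move=> p0 e0 e1.
have D x : 0 < x -> derivable (fun u : R => p^-1 * u `^ p) x 1.
  move=> x0; apply: derivableM => //; apply: derivable_powR.
  by rewrite in_itv/= x0.
have C q x : 0 < x -> {for x, continuous (fun u : R => u `^ q)}.
  move=> x0; apply/differentiable_continuous/derivable1_diffP.
  by apply: derivable_powR; rewrite in_itv/= x0.
have CF x : 0 < x -> {for x, continuous (fun u : R => p^-1 * u `^ p)}.
  by move=> x0; apply/differentiable_continuous/derivable1_diffP/D.
rewrite (@continuous_FTC2 _ _ (fun u : R => p^-1 * u `^ p))//.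
- by rewrite powR1 mulr1 -EFinB.
- apply: continuous_in_subspaceT => x /set_mem/=; rewrite in_itv/= => /andP[ex _].
  exact/C/lt_le_trans/ex.
- split.
  + by move=> x; rewrite in_itv/= => /andP[ex _]; apply/D/lt_trans/ex.
  + by apply: cvg_at_right_filter; exact: CF.
  + by apply: cvg_at_left_filter; exact: CF.
- move=> x; rewrite in_itv/= => /andP[ex _]; have x0 := lt_trans e0 ex.
  rewrite derive1Ml ?powR_derive1 ?in_itv/= ?x0//; last first.
    by apply: derivable_powR; rewrite in_itv/= x0.
  by rewrite mulKf ?gt_eqF.
Qed.

(** This single Beta value drives the recursion for Gamma. Reflection moves the singularity from 1
    to 0, and monotone convergence then exhausts the interval by pieces that avoid 0. *)
Lemma eBetap1 p : 0 < p -> eBeta p 1 = (p^-1)%:E.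
Proof.
move=> p0.
have mB : measurable_fun setT (fun u => (pospow p (1 - u) * pospow 1 u)%:E).
  by apply/measurable_EFinP; exact: measurable_pospow_beta.
rewrite /eBeta; have -> := integral_isometry 1 (normrN1 R) mB.
transitivity (\int[mu]_(u in `]0%R, 1%R[) (u `^ (p - 1))%:E)%E.
  rewrite [RHS]integral_mkcond; apply: eq_integral => u _.
  rewrite patchE mem_setE in_itv/= /pospow subrr mulN1r opprD opprK addrC subrK.
  rewrite [- u + 1]addrC subr_gt0.
  by case: ifP => [u0|_]; case: ifP => _ ; rewrite ?mul0r ?mulr0 ?powRr0 ?mulr1.
rewrite integral_itv_bndo_bndc; last first.
  by apply/measurable_EFinP/measurable_funTS; exact: measurable_powR.
(* [n.+2] keeps the left endpoint strictly below 1, as [integral_powR] demands. *)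
pose F n : set R := `[(n.+2%:R)^-1, 1]%classic.
have -> : `]0, 1]%classic = \bigcup_n F n :> set R.
  apply/seteqP; split => [x /=|x [n _]]; rewrite /F/= !in_itv/=.
    move=> /andP[x0 x1]; have [N N0] : exists N : nat, x^-1 < N.+2%:R.
      exists (Num.truncn x^-1).
      apply: lt_trans (truncnS_gt _) _.
      by rewrite ltr_nat.
    exists N => //=; rewrite in_itv/= x1 andbT -[x]invrK lef_pV2 ?posrE ?invr_gt0//.
    exact: ltW.
  by move=> /andP[nx ->]; rewrite andbT (lt_le_trans _ nx)// invr_gt0.
have ndF : nondecreasing_seq F.
  apply/nondecreasing_seqP => n; rewrite /F subsetEset.
  apply: subset_itvr; rewrite bnd_simp lef_pV2 ?posrE//.
  by rewrite ler_nat.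
have mf n : measurable_fun (F n) (fun u : R => (u `^ (p - 1))%:E).
  by apply/measurable_EFinP/measurable_funTS; exact: measurable_powR.
have f0 n x : F n x -> (0 <= (x `^ (p - 1))%:E)%E by rewrite lee_fin powR_ge0.
have mF n : measurable (F n) by exact: measurable_itv.
have cv := @ge0_nondecreasing_set_cvg_integral _ (measurableTypeR R) R F
  (fun u => (u `^ (p - 1))%:E) lebesgue_measure ndF mF mf f0.
apply: (cvg_unique _ cv) => //.
have -> : (fun n => \int[mu]_(u in F n) (u `^ (p - 1))%:E)%E =
    (fun n => (p^-1 - p^-1 * (n.+2%:R^-1) `^ p)%:E).
  by apply/funext => n; rewrite integral_powR ?invr_gt0 ?invf_lt1 ?ltr1n.
apply: cvg_EFin; first exact: nearW.
rewrite -[X in _ --> X]subr0 -[X in _ --> _ - X](mulr0 p^-1).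
apply: cvgB; first exact: cvg_cst.
apply: cvgMr.
have /cvg_at_rightP := powR_cvg0 p0; apply; split => [n|].
  by rewrite invr_gt0.
have := @cvg_harmonic R; rewrite -(cvg_shiftn 1) /=.
by apply: cvg_trans; apply: near_eq_cvg; apply: nearW => n /=; rewrite addn1.
Qed.

(** This is the product formula [eGammaM] at q = 1, in place of an integration by parts. *)
Lemma eGammaS p : 0 < p -> eGamma p = ((p^-1)%:E * eGamma (p + 1))%E.
Proof. by move=> p0; rewrite -eBetap1// -eGammaM eGamma1 mule1. Qed.

Lemma eGamma_nat (n : nat) : (eGamma n.+1%:R < +oo)%E.
Proof.
elim: n => [|n IH]; first by rewrite eGamma1 ltry.
have n0 : 0 < n.+1%:R :> R by [].
have -> : eGamma n.+2%:R = (n.+1%:R%:E * eGamma n.+1%:R)%E.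
  by rewrite [in RHS]eGammaS// muleA -EFinM mulfV ?gt_eqF// mul1e natr1.
by apply: lte_mul_pinfty => //; rewrite lee_fin ltW.
Qed.

Lemma eGamma_lty p : 0 < p -> (eGamma p < +oo)%E.
Proof.
have ge1 q : 1 <= q -> (eGamma q < +oo)%E.
  move=> q1; pose N := (Num.truncn q).+1.
  have qN : q <= N%:R by apply/ltW/truncnS_gt.
  (* For u >= 1 the power q - 1 is at most the power N - 1, and for 0 < u <= 1 it is at most 1;
     these are the powers in the two Gamma integrands. *)
  apply: (@le_lt_trans _ _ (eGamma 1 + eGamma N%:R)%E); last first.
    by apply: lte_add_pinfty; [rewrite eGamma1 ltry|exact: eGamma_nat].
  
  rewrite /eGamma -ge0_integralD//; last 4 first.
  - by move=> u _; rewrite lee_fin pospow_expR_ge0.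
  - by apply/measurable_EFinP; exact: measurable_pospow_expR.
  - by move=> u _; rewrite lee_fin pospow_expR_ge0.
  - by apply/measurable_EFinP; exact: measurable_pospow_expR.
  apply: ge0_le_integral => //.
  - by move=> u _; rewrite lee_fin pospow_expR_ge0.
  - by apply/measurable_EFinP; exact: measurable_pospow_expR.
  - apply/measurable_EFinP; apply: measurable_funD;
      exact: measurable_pospow_expR.
  move=> u _; rewrite -EFinD lee_fin -mulrDl ler_wpM2r ?expR_ge0//.
  rewrite /pospow; case: ifP => [u0|]; last by rewrite addr0.
  have [u1|u1] := leP 1 u.
    by rewrite (le_trans (ler_powR u1 (lerB qN (lexx _))))// lerDr powR_ge0.
  apply: le_trans (ger_powR _ (lerB q1 (lexx _))) _; first by rewrite u0 ltW.
  by rewrite lerDl powR_ge0.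
(* The recursion trades the singularity at 0 for the argument p + 1 >= 1. *)
move=> p0; rewrite eGammaS//; apply: lte_mul_pinfty => //.
  by rewrite lee_fin invr_ge0 ltW.
by apply: ge1; rewrite lerDr ltW.
Qed.

Lemma eGamma_gt0 p : (0 < eGamma p)%E.
Proof.
rewrite /eGamma (_ : (\int[mu]_u _)%E =
  (\int[mu]_(u in `]0%R, +oo[) (pospow p u * expR (- u))%:E)%E); last first.
  rewrite [RHS]integral_mkcond; apply: eq_integral => u _.
  rewrite patchE mem_setE in_itv/= andbT.
  by case: ifPn => // u0; rewrite /pospow (negbTE u0) mul0r.
apply: integral_gt0 => //.
- by rewrite lebesgue_measure_itv/= ltry.
- by apply/measurable_EFinP/measurable_funTS; exact: measurable_pospow_expR.
- move=> u; rewrite /= in_itv/= andbT lte_fin => u0.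
  by rewrite /pospow u0 mulr_gt0 ?expR_gt0 ?powR_gt0.
Qed.

Lemma EFin_Gamma p : 0 < p -> (Gamma p)%:E = eGamma p.
Proof.
by move=> p0; rewrite GammaE fineK// ge0_fin_numE ?eGamma_lty// ltW ?eGamma_gt0.
Qed.

Lemma Gamma_gt0 p : 0 < p -> 0 < Gamma p.
Proof. by move=> p0; rewrite -lte_fin EFin_Gamma// eGamma_gt0. Qed.

Lemma Gamma1 : Gamma 1 = 1 :> R.
Proof. by apply/EFin_inj; rewrite EFin_Gamma// eGamma1. Qed.

Lemma GammaS p : 0 < p -> Gamma (p + 1) = p * Gamma p.
Proof.
move=> p0; apply/EFin_inj; rewrite EFinM !EFin_Gamma ?addr_gt0//.
by rewrite [in RHS]eGammaS// muleA -EFinM mulfV ?gt_eqF// mul1e.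
Qed.

End gamma.

(* Convolution kernel of the fractional integral; locked, since unification would
   otherwise unfold it down to the Gamma integral. *)
HB.lock Definition rlker {R : realType} (p u : R) : R := (Gamma p)^-1 * pospow p u.

(** * The normalized kernel *)

Section rlker.
Local Open Scope classical_set_scope.
Context {R : realType}.
Local Notation mu := (@lebesgue_measure R).
Implicit Types p q x t u : R.

Lemma rlker_ge0 p u : 0 < p -> 0 <= rlker p u.
Proof. by move=> p0; rewrite unlock mulr_ge0 ?pospow_ge0// invr_ge0 ltW ?Gamma_gt0. Qed.

Lemma measurable_rlker p : measurable_fun setT (rlker p).
Proof. by rewrite unlock; apply: measurable_funM => //; exact: measurable_pospow. Qed.

(** Dividing by Gamma absorbs the Beta constant exactly: this is the semigroup law at the level of
    kernels. *)
Lemma rlker_conv p q x : 0 < p -> 0 < q ->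
  (\int[mu]_u (rlker p (x - u) * rlker q u)%:E = (rlker (p + q) x)%:E)%E.
Proof.
move=> p0 q0.
have E u : (rlker p (x - u) * rlker q u)%:E =
  (((Gamma p)^-1 * (Gamma q)^-1)%:E * (pospow p (x - u) * pospow q u)%:E)%E.
  by rewrite -EFinM rlker.unlock; congr (_%:E); ring.
under eq_integral do rewrite E.
rewrite ge0_integral_EFinZl; last 3 first.
- exact: measurable_pospow_beta.
- exact: pospow_beta_ge0.
- by rewrite lee_fin mulr_ge0// invr_ge0 ltW ?Gamma_gt0.
rewrite pospow_conv.
have g0 : 0 < Gamma (p + q) by rewrite Gamma_gt0 ?addr_gt0.
have -> : eBeta p q = (Gamma p * Gamma q / Gamma (p + q))%:E.
  rewrite !EFinM !EFin_Gamma// eGammaM -EFin_Gamma ?addr_gt0// -muleA -EFinM.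
  by rewrite mulfV ?gt_eqF// mule1.
rewrite -!EFinM rlker.unlock; congr (_%:E).
move: g0 (Gamma_gt0 p0) (Gamma_gt0 q0) (pospow _ x).
move: (Gamma (p + q)) (Gamma p) (Gamma q) => g gp gq g0 gp0 gq0 w.
by field; rewrite !gt_eqF.
Qed.

Lemma rlker_le0 p u : u <= 0 -> rlker p u = 0.
Proof. by rewrite leNgt rlker.unlock /pospow => /negbTE ->; rewrite mulr0. Qed.

(** At order 1 the kernel is the Heaviside function. It makes [rlop 1] a primitive, and it also
    serves as the indicator of a half-line in majorants. *)
Lemma rlker1 u : rlker 1 u = (0 < u)%R%:R.
Proof.
by rewrite rlker.unlock /pospow Gamma1 invr1 mul1r subrr powRr0; case: ifP.
Qed.

Lemma rlker_le p u v : 1 <= p -> u <= v -> rlker p u <= rlker p v.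
Proof.
move=> p1 uv; have p0 : 0 < p by exact: lt_le_trans p1.
rewrite rlker.unlock ler_pM2l ?invr_gt0 ?Gamma_gt0// /pospow.
case: ifP => u0; case: ifP => v0 //; last exact: powR_ge0.
  by rewrite ge0_ler_powR ?subr_ge0// nnegrE ltW.
by rewrite (lt_le_trans u0 uv) in v0.
Qed.

End rlker.

(** * Convolution with the kernel and the semigroup law *)

Section rlop.
Local Open Scope classical_set_scope.
Context {R : realType}.
Local Notation mu := (@lebesgue_measure R).
Implicit Types (p q x t u : R) (f g : R -> R).

Definition rlop p f x : R := \int[mu]_t (rlker p (x - t) * f t).

Lemma measurable_rlker_sub p (x : R) :
  measurable_fun setT (fun t : R => rlker p (x - t)).
Proof.
apply: measurableT_comp; first exact: measurable_rlker.
exact: measurable_funB.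
Qed.

Lemma measurable_rlker_subM p (x : R) f : measurable_fun setT f ->
  measurable_fun setT (fun t : R => rlker p (x - t) * f t).
Proof. by move=> mf; apply: measurable_funM => //; exact: measurable_rlker_sub. Qed.

(** Causality: the kernel vanishes for t >= x. This lets functions be extended or altered freely to
    the right of x. *)
Lemma eq_rlop p f g x : (forall t, t < x -> f t = g t) ->
  rlop p f x = rlop p g x.
Proof.
move=> fg; apply: eq_Rintegral => t _; have [/fg -> //|xt] := ltP t x.
by rewrite rlker_le0 ?subr_le0// !mul0r.
Qed.

(** Tonelli makes the integrals of the positive and negative parts measurable; taking [fine] of
    their difference also covers the points of divergence. *)
Lemma measurable_rlop p f : measurable_fun setT f ->
  measurable_fun setT (rlop p f).
Proof.
move=> mf.
pose h (z : R * R) := (rlker p (z.1 - z.2) * f z.2)%:E.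
have mh : measurable_fun setT h.
  apply/measurable_EFinP; apply: measurable_funM.
    apply: measurableT_comp; first exact: measurable_rlker.
    exact: measurable_funB.
  by apply: measurableT_comp.
have -> : rlop p f = fine \o (fun x => (\int[mu]_t h^\+ (x, t) - \int[mu]_t h^\- (x, t))%E).
  apply/funext => x /=; rewrite /rlop /Rintegral integralE; congr (fine (_ - _)).
    by apply: eq_integral => t _; rewrite !funeposE.
  by apply: eq_integral => t _; rewrite !funenegE.
apply: measurableT_comp => //; apply: emeasurable_funB.
  by apply: measurable_fun_fubini_tonelli_F => //; exact: measurable_funepos.
by apply: measurable_fun_fubini_tonelli_F => //; exact: measurable_funeneg.
Qed.

Lemma measurable_rlker2 p q (x t : R) :
  measurable_fun setT (fun s : R => rlker p (x - s) * rlker q (s - t)).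
Proof.
apply: measurable_rlker_subM; apply: (measurableT_comp (measurable_rlker q)).
exact: measurable_funB.
Qed.

Lemma rlker_conv_sub p q x t : 0 < p -> 0 < q ->
  (\int[mu]_s (rlker p (x - s) * rlker q (s - t))%:E = (rlker (p + q) (x - t))%:E)%E.
Proof.
move=> p0 q0; have <- := rlker_conv (x - t) p0 q0.
have /measurable_EFinP mk := measurable_rlker2 p q x t.
have -> := integral_isometry t (normr1 R) mk.
apply: eq_integral => s _ /=; rewrite mul1r addrK; congr ((rlker p _ * _)%:E); ring.
Qed.

Lemma integrable_rlker2 p q x t : 0 < p -> 0 < q ->
  mu.-integrable setT (fun s => (rlker p (x - s) * rlker q (s - t))%:E).
Proof.
move=> p0 q0; apply/integrableP; split.
  by apply/measurable_EFinP; exact: measurable_rlker2.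
rewrite (_ : integral _ _ _ = (rlker (p + q) (x - t))%:E) ?ltry//.
rewrite -rlker_conv_sub//; apply: eq_integral => s _.
by rewrite gee0_abs// lee_fin mulr_ge0 ?rlker_ge0.
Qed.

Section composition.
Variables (p q x : R) (f : R -> R).
Hypotheses (p0 : 0 < p) (q0 : 0 < q) (mf : measurable_fun setT f).
Hypothesis kf : mu.-integrable setT (fun t => (rlker (p + q) (x - t) * f t)%:E).

Let h (z : R * R) := (rlker p (x - z.1) * rlker q (z.1 - z.2) * f z.2)%:E.

Let mh : measurable_fun setT h.
Proof.
apply/measurable_EFinP; apply: measurable_funM; last exact: measurableT_comp.
apply: measurable_funM.
  by apply: (measurableT_comp (measurable_rlker p)); exact: measurable_funB.
by apply: (measurableT_comp (measurable_rlker q)); exact: measurable_funB.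
Qed.

(** Integrating [|h|] over s first merges the two kernels into the one of order p + q, and what
    remains is the integral bounded by [kf]. *)
Let ih : (mu \x mu)%E.-integrable setT h.
Proof.
apply/integrable21ltyP; first exact: mh.
move/integrableP: kf => [_]; apply: le_lt_trans.
rewrite le_eqVlt; apply/orP; left; apply/eqP/eq_integral => t _; apply/esym.
transitivity (`|f t|%:E * (rlker (p + q) (x - t))%:E)%E.
  by rewrite -EFinM abse_EFin normrM [`|rlker _ _|]ger0_norm ?rlker_ge0 ?addr_gt0// mulrC.
rewrite -rlker_conv_sub//.
have mk := measurable_rlker2 p q x t.
have k0 s : 0 <= rlker p (x - s) * rlker q (s - t) by rewrite mulr_ge0 ?rlker_ge0.
rewrite -(ge0_integral_EFinZl mk)//; apply: eq_integral => s _.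
by rewrite /h/= normrM (ger0_norm (k0 _)) -EFinM mulrC.
Qed.

(** Where the outer kernel vanishes both sides are 0, whatever value [rlop q f s] has. Elsewhere,
    for almost every s, dividing by that kernel shows that the inner integral converges, so [fine]
    loses nothing. *)
Let inner : {ae mu, forall s,
  fubini_F mu h s = (rlker p (x - s) * rlop q f s)%:E}.
Proof.
have := ae_integrable1 ih; apply: filterS => s is_.
have [k0|k0] := eqVneq (rlker p (x - s)) 0.
  rewrite k0 mul0r; apply: integral0_eq => t _; by rewrite /h/= k0 !mul0r.
have iq : mu.-integrable setT (fun t => (rlker q (s - t) * f t)%:E).
  have := integrableZl measurableT (rlker p (x - s))^-1 is_.
  apply: eq_integrable => // t _; rewrite /h/= -EFinM; congr (_%:E).
  by rewrite -mulrA mulKf.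
rewrite /rlop -RintegralZl// /Rintegral fineK.
  by apply: eq_integral => t _; rewrite /h/= mulrA.
have : (\int[mu]_t h (s, t))%E \is a fin_num by exact: integrable_fin_num.
congr (_ \is a fin_num); apply: eq_integral => t _; by rewrite /h/= mulrA.
Qed.

Lemma integrable_rlop_comp :
  mu.-integrable setT (fun s => (rlker p (x - s) * rlop q f s)%:E).
Proof.
apply/integrableP; split.
  by apply/measurable_EFinP; exact: (measurable_rlker_subM _ _ (measurable_rlop _ mf)).
have /integrableP[mF] := integrable_fubini_F ih.
apply: le_lt_trans; rewrite le_eqVlt; apply/orP; left; apply/eqP.
apply: ae_eq_integral => //.
- apply/measurable_EFinP; apply: measurableT_comp => //.
  exact: (measurable_rlker_subM _ _ (measurable_rlop _ mf)).
- by apply: measurableT_comp => //; exact: mF.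
- case: inner => N [mN N0 sub]; exists N; split => // s ns; apply: sub => E.
  by apply: ns => _; congr (`|_|%E); exact: esym E.
Qed.

Lemma rlop_comp : rlop p (rlop q f) x = rlop (p + q) f x.
Proof.
transitivity (fine (\int[mu]_s (rlker p (x - s) * rlop q f s)%:E)%E) => //.
rewrite [RHS]/rlop /Rintegral; congr fine.
have mF := measurable_fubini_F ih.
transitivity (\int[mu]_s fubini_F mu h s)%E.
  apply: ae_eq_integral => //.
  - by apply/measurable_EFinP; exact: (measurable_rlker_subM _ _ (measurable_rlop _ mf)).
  - case: inner => N [mN N0 sub]; exists N; split => // s ns; apply: sub => E.
  by apply: ns => _; exact: esym E.
rewrite (integral12_prod_meas1 ih) -(integral21_prod_meas1 ih).
apply: eq_integral => t _; rewrite /fubini_G /h /=.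
by rewrite EFinM -rlker_conv_sub// -integralZr//; exact: integrable_rlker2.
Qed.

End composition.

(** The majorant [M * (rlker p (x - t) * rlker 1 (t - a))] is integrable since its integral is M
    times a kernel of order p + 1. *)
Lemma integrable_rlker_bounded p f (a M : R) (x : R) : 0 < p ->
  measurable_fun setT f -> (forall t, t <= a -> f t = 0) ->
  (forall t, `|f t| <= M) ->
  mu.-integrable setT (fun t => (rlker p (x - t) * f t)%:E).
Proof.
move=> p0 mf fa fM.
have := integrableZl measurableT M (integrable_rlker2 x a p0 ltr01).
apply: le_integrable => //.
  by apply/measurable_EFinP; exact: measurable_rlker_subM.
move=> t _ /=; rewrite lee_fin normrM normrM.
have M0 : 0 <= M by apply: le_trans (fM 0).
rewrite normrM (ger0_norm M0) (ger0_norm (rlker_ge0 (x - t) p0)).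
rewrite (ger0_norm (rlker_ge0 (t - a) ltr01)) rlker1 subr_gt0 mulrCA.
rewrite ler_wpM2l ?rlker_ge0//.
by have [|/fa ->] := ltP a t; rewrite ?mulr1// normr0 mulr0.
Qed.

(** From order 1 on the kernel is nondecreasing, hence at most [rlker p (x - a)] on the support of
    f. *)
Lemma integrable_rlker_ge1 p f (a : R) (x : R) : 1 <= p ->
  mu.-integrable setT (EFin \o f) -> (forall t, t < a -> f t = 0) ->
  mu.-integrable setT (fun t => (rlker p (x - t) * f t)%:E).
Proof.
move=> p1 intf fa; have p0 : 0 < p by exact: lt_le_trans p1.
have /integrableP[/measurable_EFinP mf _] := intf.
have := integrableZl measurableT (rlker p (x - a)) intf.
apply: le_integrable => //.
  by apply/measurable_EFinP; exact: measurable_rlker_subM.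
move=> t _ /=; rewrite lee_fin normrM normrM.
have [/fa ->|xt] := ltP t a; first by rewrite normr0 !mulr0.
by rewrite ler_wpM2r// !ger0_norm ?rlker_ge0// rlker_le// lerB.
Qed.

(** The factor [rlker (p + 1) (x - a)] is the integral of the kernel over t from a to x, obtained as
    a convolution with the order 1 kernel. *)
Lemma rlop_le p f g (a e : R) (x : R) : 0 < p ->
  mu.-integrable setT (fun t => (rlker p (x - t) * f t)%:E) ->
  mu.-integrable setT (fun t => (rlker p (x - t) * g t)%:E) ->
  (forall t, t <= a -> f t = g t) -> (forall t, t < x -> `|f t - g t| <= e) ->
  `|rlop p f x - rlop p g x| <= e * rlker (p + 1) (x - a).
Proof.
move=> p0 kf kg fg0 fge.
rewrite /rlop -RintegralB//.
have ifg : mu.-integrable setT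
    (fun t => (rlker p (x - t) * f t - rlker p (x - t) * g t)%:E).
  exact: (integrableB measurableT kf kg).
apply: le_trans (le_normr_Rintegral _ ifg) _ => //.
rewrite -[rlker (p + 1) _]/(fine (_%:E)) -rlker_conv_sub//.
rewrite -RintegralZl//; last exact: integrable_rlker2.
apply: le_Rintegral => //.
- exact: integrable_norm.
- exact: (integrableZl measurableT e (integrable_rlker2 x a p0 ltr01)).
move=> t _; rewrite -mulrBr normrM ger0_norm ?rlker_ge0// mulrCA.
have [xt|tx] := leP x t; first by rewrite rlker_le0 ?subr_le0// !mul0r.
rewrite ler_wpM2l ?rlker_ge0// rlker1 subr_gt0.
by have [_|/fg0 ->] := ltP a t; rewrite ?mulr1 ?fge// subrr normr0 mulr0.
Qed.

End rlop.

(** * Test functions and integration by parts *)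

Section test_fun.
Local Open Scope classical_set_scope.
Context {R : realType}.
Local Notation mu := (@lebesgue_measure R).
Variables a b : R.
Implicit Types (f phi : R -> R) (x t : R).

Lemma integrable_supported (D : set R) f : measurable D ->
  mu.-integrable D (EFin \o f) -> (forall x, ~ D x -> f x = 0) ->
  mu.-integrable setT (EFin \o f).
Proof.
move=> mD intf f0.
have : mu.-integrable setT ((EFin \o f) \_ D).
  by have /= := integrable_mkcond (mu := mu) (EFin \o f) mD; case => + _; apply.
apply: eq_integrable => // x _.
rewrite patchE; case: ifPn => // /negP; rewrite inE => /f0 fx.
by rewrite /= fx.
Qed.

Lemma derivable_continuous f : (forall x, derivable f x 1) -> continuous f.
Proof. by move=> df x; apply/differentiable_continuous/derivable1_diffP. Qed.

Lemma test_fun_derivable phi : test_fun a b phi -> forall x, derivable phi x 1.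
Proof. by move=> [d _] x; exact: (d 0%N). Qed.

Lemma test_fun_derive1 phi : test_fun a b phi -> test_fun a b (derive1 phi).
Proof.
move=> [dphi [c [d [ac db phi0]]]]; split.
  by move=> k x; have := dphi k.+1 x; rewrite iterSr.
exists c, d; split => // x xcd.
rewrite derive1E (@near_eq_derive _ _ _ phi (cst 0)) ?derive_cst ?oner_neq0//.
case: xcd => [xc|dx].
  by near=> z; apply: phi0; left; near: z; exact: lt_nbhsl.
near=> z; apply: phi0; right; near: z; exact: lt_nbhsr.
Unshelve. all: by end_near. Qed.

Lemma test_fun_continuous phi : test_fun a b phi -> continuous phi.
Proof. by move=> /test_fun_derivable; exact: derivable_continuous. Qed.

Lemma test_fun_out phi x : test_fun a b phi -> ~~ (a < x < b) -> phi x = 0.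
Proof.
move=> [_ [c [d [ac db phi0]]]]; rewrite negb_and -!leNgt => /orP[xa|bx].
  by apply: phi0; left; exact: le_lt_trans ac.
by apply: phi0; right; exact: lt_le_trans bx.
Qed.

Lemma test_fun_bounded phi : test_fun a b phi -> exists M, forall x, `|phi x| <= M.
Proof.
move=> tphi.
have [ab|ba] := leP a b; last first.
  exists 0 => x; rewrite (test_fun_out tphi) ?normr0//.
  apply/negP => /andP[ax xb]; have := lt_trans (lt_trans ax xb) ba; by rewrite ltxx.
have cphi : {within `[a, b], continuous (fun x => `|phi x|)}.
  apply: continuous_subspaceT => x; apply: (@continuous_comp _ _ _ phi Num.norm).
    exact: test_fun_continuous.
  exact: norm_continuous.
have [c _ cmax] := EVT_max ab cphi.
exists `|phi c| => x; have [xab|nxab] := boolP (a < x < b).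
  by apply: cmax; rewrite in_itv/=; case/andP: xab => /ltW -> /ltW ->.
by rewrite (test_fun_out tphi nxab) normr0.
Qed.

Lemma test_fun_integrable phi : test_fun a b phi ->
  mu.-integrable setT (EFin \o phi).
Proof.
move=> tphi; apply: (@integrable_supported `[a, b]%classic) => //.
  apply: continuous_compact_integrable; first exact: segment_compact.
  exact/continuous_subspaceT/test_fun_continuous.
move=> x /= nx; apply: (test_fun_out tphi); apply/negP => /andP[ax xb]; apply: nx.
by rewrite in_itv/= !ltW.
Qed.

Lemma Rintegral_test_fun f phi : test_fun a b phi ->
  \int[mu]_(x in `]a, b[) (f x * phi x) = \int[mu]_x (f x * phi x).
Proof.
move=> tphi; rewrite Rintegral_mkcond; apply: eq_Rintegral => x _.
rewrite patchE; case: ifPn => //; rewrite mem_setE in_itv/= => nx.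
by rewrite (test_fun_out tphi nx) mulr0.
Qed.

Lemma Rintegral_derive1 f (x y : R) : x < y ->
  (forall z, derivable f z 1) -> continuous (derive1 f) ->
  \int[mu]_(t in `[x, y]) derive1 f t = f y - f x.
Proof.
move=> xy df cf'; have cf := derivable_continuous df.
suff E : (\int[mu]_(t in `[x, y]) (derive1 f t)%:E = (f y)%:E - (f x)%:E)%E.
  by rewrite /Rintegral E.
apply: (continuous_FTC2 xy).
- exact: continuous_subspaceT.
- split; first by move=> z _; exact: df.
  + apply: cvg_at_right_filter; exact: (cf x).
  + apply: cvg_at_left_filter; exact: (cf y).
- by move=> z _.
Qed.

Lemma Rintegral_rlker1_derive1 phi t : test_fun a b phi ->
  \int[mu]_x (rlker 1 (x - t) * derive1 phi x) = - phi t.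
Proof.
move=> tphi; have tphi' := test_fun_derive1 tphi.
(* A point beyond both t and the support, so that phi vanishes there and [t < y]. *)
pose y := Num.max b t + 1.
have ty : t < y by rewrite /y ltr_pwDr// le_max lexx orbT.
have yb : b < y by rewrite /y ltr_pwDr// le_max lexx.
have phiy : phi y = 0.
  by apply: (test_fun_out tphi); rewrite negb_and -!leNgt (ltW yb) orbT.
rewrite -[- phi t]add0r -phiy -Rintegral_derive1//; last 2 first.
- exact: test_fun_derivable.
- exact: test_fun_continuous.
rewrite -Rintegral_itv_obnd_cbnd; last first.
  exact: integrableS (test_fun_integrable tphi').
rewrite [RHS]Rintegral_mkcond; apply: eq_Rintegral => x _.
rewrite patchE mem_setE in_itv/= rlker1 subr_gt0.
have [tx|xt]/= := ltP t x; last by rewrite mul0r.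
case: ifPn => [_|]; first by rewrite mul1r.
rewrite -ltNge => yx; rewrite (test_fun_out tphi') ?mulr0//.
by rewrite negb_and -!leNgt (ltW (lt_trans yb yx)) orbT.
Qed.

(* Only integrability of [f] is needed because the proof is Fubini on [t < x]. *)
Lemma rlop1_parts f phi : mu.-integrable setT (EFin \o f) -> test_fun a b phi ->
  \int[mu]_(x in `]a, b[) (rlop 1 f x * derive1 phi x) =
  - \int[mu]_(x in `]a, b[) (f x * phi x).
Proof.
move=> intf tphi; have tphi' := test_fun_derive1 tphi.
have /integrableP[/measurable_EFinP mf _] := intf.
have /integrableP[/measurable_EFinP mphi' _] := test_fun_integrable tphi'.
have [M phiM] := test_fun_bounded tphi.
rewrite !Rintegral_test_fun//.
pose h (z : R * R) := (rlker 1 (z.1 - z.2) * f z.2 * derive1 phi z.1)%:E.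
have mh : measurable_fun setT h.
  apply/measurable_EFinP; apply: measurable_funM; last exact: measurableT_comp.
  apply: measurable_funM; last exact: measurableT_comp.
  by apply: (measurableT_comp (measurable_rlker 1)); exact: measurable_funB.
have k1 x t : `|rlker 1 (x - t)| <= 1 :> R.
  by rewrite rlker1 normr_nat; case: (0 < x - t)%R.
have ikf x : mu.-integrable setT (fun t => (rlker 1 (x - t) * f t)%:E).
  apply: le_integrable intf => //.
    by apply/measurable_EFinP; exact: measurable_rlker_subM.
  by move=> t _; rewrite lee_fin normrM ler_piMl.
have ih : (mu \x mu)%E.-integrable setT h.
  apply/integrable12ltyP => //.
  have /integrableP[_ If] := intf.
  have /integrableP[_ Iphi] := test_fun_integrable tphi'.
  apply: (@le_lt_trans _ _ (\int[mu]_x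
    ((\int[mu]_t `|(f t)%:E|) * `|(derive1 phi x)%:E|))%E); last first.
    rewrite ge0_integralZl//.
    - by apply: lte_mul_pinfty => //; [exact: integral_ge0|rewrite ge0_fin_numE// integral_ge0].
    - by apply/measurable_EFinP; exact: measurableT_comp.
    - exact: integral_ge0.
  apply: ge0_le_integral => //.
  - by move=> x _; exact: integral_ge0.
  - have mah : measurable_fun setT (abse \o h) by exact: measurableT_comp.
    by apply: (measurable_fun_fubini_tonelli_F (m2 := mu) (abse \o h) mah) => z; exact: abse_ge0.
  - apply: emeasurable_funM => //.
    by apply/measurable_EFinP; exact: measurableT_comp.
  move=> x _; rewrite muleC -ge0_integralZl//; last first.
    by apply/measurable_EFinP; exact: measurableT_comp.
  apply: ge0_le_integral => //.
  - apply: measurableT_comp => //; exact: measurableT_comp mh _.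
  - by apply/measurable_EFinP; apply: measurable_funM => //; exact: measurableT_comp.
  move=> t _; rewrite /h/= lee_fin !normrM mulrC ler_wpM2l//.
  by rewrite ler_piMl.
transitivity (fine (\int[mu]_x fubini_F mu h x)%E).
  congr fine; apply: eq_integral => x _; rewrite /fubini_F /rlop.
  rewrite EFinM fineK; last exact: (integrable_fin_num _ (ikf x)).
  by rewrite -integralZr.
rewrite (integral12_prod_meas1 ih) -(integral21_prod_meas1 ih).
transitivity (fine (\int[mu]_t (- (f t * phi t))%:E)%E).
  congr fine; apply: eq_integral => t _; rewrite /fubini_G /h/=.
  rewrite -mulrN -(Rintegral_rlker1_derive1 t tphi).
  have ikp : mu.-integrable setT (fun x => (rlker 1 (x - t) * derive1 phi x)%:E).
    apply: le_integrable (test_fun_integrable tphi') => //.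
      apply/measurable_EFinP; apply: measurable_funM => //.
      by apply: (measurableT_comp (measurable_rlker 1)); exact: measurable_funB.
    by move=> x _; rewrite lee_fin normrM ler_piMl.
  rewrite EFinM fineK; last exact: (integrable_fin_num _ ikp).
  rewrite -integralZl//; apply: eq_integral => x _; rewrite -EFinM.
  by congr (_%:E); ring.
transitivity (\int[mu]_t (- 1 * (f t * phi t))).
  by congr fine; apply: eq_integral => t _; rewrite mulN1r.
rewrite RintegralZl ?mulN1r//.
apply: le_integrable (integrableZl measurableT M intf) => //.
  apply/measurable_EFinP; apply: measurable_funM => //.
  by have /integrableP[/measurable_EFinP] := test_fun_integrable tphi.
move=> t _ /=; rewrite lee_fin !normrM mulrC ler_wpM2r//.
by rewrite (le_trans (phiM t))// ler_norm.
Qed.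

End test_fun.

(** * Continuity of fractional integrals of continuous functions *)

Section continuity.
Local Open Scope classical_set_scope.
Context {R : realType}.
Local Notation mu := (@lebesgue_measure R).
Implicit Types (f G : R -> R) (x t p : R).

Lemma rlop_conv p f x : measurable_fun setT f ->
  rlop p f x = \int[mu]_u (rlker p u * f (x - u)).
Proof.
move=> mf; rewrite /rlop /Rintegral; congr fine.
have /measurable_EFinP mk := measurable_rlker_subM p x mf.
have -> := integral_isometry x (normrN1 R) mk.
apply: eq_integral => u _ /=; congr ((rlker p _ * f _)%:E); ring.
Qed.

(* After the change of variable [u = x - t] the singular factor no longer depends
   on [x], so dominated convergence applies. *)
Lemma continuous_rlop p f a M : 0 < p -> continuous f ->
  (forall t, t <= a -> f t = 0) -> (forall t, `|f t| <= M) ->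
  continuous (rlop p f).
Proof.
move=> p0 cf fa fM x.
have mf : measurable_fun setT f by exact: continuous_measurable_fun.
have -> : rlop p f = (fun y => \int[mu]_u (rlker p u * f (y - u))).
  by apply/funext => y; exact: rlop_conv.
pose c := x + 1.
pose g (u : R) := M * (rlker 1 ((c - a) - u) * rlker p (u - 0)).
have M0 : 0 <= M by apply: le_trans (fM 0).
have ig : mu.-integrable setT (EFin \o g).
  exact: (integrableZl measurableT M (integrable_rlker2 (c - a) 0 ltr01 p0)).
have fg y u : y < c -> `|rlker p u * f (y - u)| <= g u.
  move=> yc; rewrite /g subr0 normrM ger0_norm ?rlker_ge0// mulrA mulrC.
  rewrite ler_wpM2r ?rlker_ge0// rlker1 subr_gt0.
  have [uca|cau] := ltP u (c - a); first by rewrite mulr1.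
  by rewrite fa ?normr0 ?mulr0// lerBlDr -lerBlDl (le_trans _ cau)// lerB// ltW.
have mfy y : measurable_fun setT (fun u : R => rlker p u * f (y - u)).
  apply: measurable_funM; first exact: measurable_rlker.
  by apply: (measurableT_comp mf); exact: measurable_funB.
have ify y : (`]x - 1, c[%classic : set R) y ->
    mu.-integrable setT (EFin \o (fun u => rlker p u * f (y - u))).
  rewrite /= in_itv/= => /andP[_ yc]; apply: le_integrable ig => //.
    by apply/measurable_EFinP; exact: mfy.
  move=> u _ /=; rewrite lee_fin (le_trans (fg _ _ yc))// ler_norm//.
apply: (@continuity_under_integral R _ (measurableTypeR R) lebesgue_measure
  (fun y u => rlker p u * f (y - u)) setT measurableT (x - 1) c ify _ g ig).
- apply: aeW => u _ y _.
  apply: (@continuousM _ R^o (cst (rlker p u)) (fun y => f (y - u))).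
    exact: cst_continuous.
  apply: (@continuous_comp _ _ _ (fun y => y - u) f); last exact: cf.
  by apply: continuousB => //; exact: cst_continuous.
- move=> y; rewrite /= in_itv/= => /andP[_ yc]; apply: aeW => u _; exact: fg.
- by rewrite inE/= in_itv/= /c; apply/andP; split; [rewrite gtrBl|rewrite ltrDl].
Qed.

End continuity.

(** * Extension from the interval to the line *)

Section extension.
Local Open Scope classical_set_scope.
Context {R : realType}.
Local Notation mu := (@lebesgue_measure R).
Variables a b : R.
Hypothesis ab : a < b.
Implicit Types (F G : R -> R) (x t : R).

(* For [F a = 0] this extends [F] continuously, vanishing on the left of [a]. *)
Definition clamp F x := F (Num.max a (Num.min b x)).

Lemma clamp_id F x : a <= x <= b -> clamp F x = F x.
Proof. by move=> /andP[ax xb]; rewrite /clamp (min_idPr xb) (max_idPr ax). Qed.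

Lemma clamp_le F t : t <= a -> clamp F t = F a.
Proof.
move=> ta; rewrite /clamp (min_idPr _) ?(max_idPl ta)//.
by rewrite (le_trans ta) ?ltW.
Qed.

Lemma clamp_itv x : a <= Num.max a (Num.min b x) <= b.
Proof. by rewrite le_max lexx/= ge_max (ltW ab)/= ge_min lexx. Qed.

(** The retraction onto [[a, b]] is continuous with values in the interval, so continuity of F
    within the interval suffices for the composition. *)
Lemma continuous_clamp F : {within `[a, b], continuous F} -> continuous (clamp F).
Proof.
move=> /subspace_continuousP cF x.
have cFx : F y @[y --> within `[a, b] (nbhs (Num.max a (Num.min b x)))] -->
    clamp F x.
  by apply: cF; rewrite /= in_itv/= clamp_itv.
have cc : {for x, continuous (fun y => Num.max a (Num.min b y))}.
  apply: (@continuous_max _ _ (cst a) (fun y => Num.min b y)).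
    exact: cst_continuous.
  by apply: (@continuous_min _ _ (cst b) id) => //; exact: cst_continuous.
apply: (@cvg_comp _ _ _ (fun y => Num.max a (Num.min b y)) F _ _ _ _ cFx).
move=> A /cc; change (nbhs x (fun y => `[a, b]%classic (Num.max a (Num.min b y)) ->
  A (Num.max a (Num.min b y))) -> nbhs x (fun y => A (Num.max a (Num.min b y)))).
by apply: filterS => y; apply; rewrite /= in_itv/= clamp_itv.
Qed.

Lemma clamp_bounded F : {within `[a, b], continuous F} ->
  exists M, forall x, `|clamp F x| <= M.
Proof.
move=> cF.
have cN : {within `[a, b], continuous (fun x => `|F x|)}.
  by move=> x; apply: continuous_comp; [exact: cF|exact: norm_continuous].
have [c _ cmax] := EVT_max (ltW ab) cN.
by exists `|F c| => x; apply: cmax; rewrite in_itv/= clamp_itv.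
Qed.

(** The constant extension and the extension by zero differ only to the right of b, which causality
    hides. *)
Lemma rlop_clamp p F x : F a = 0 -> x <= b ->
  rlop p (clamp F) x = rlop p (F \_ `[a, b]) x.
Proof.
move=> Fa xb; apply: eq_rlop => t tx; rewrite patchE mem_setE in_itv/=.
have [at_|ta]/= := leP a t.
  by rewrite (ltW (lt_le_trans tx xb)) clamp_id// at_ (ltW (lt_le_trans tx xb)).
by rewrite clamp_le// ltW.
Qed.

Lemma rlop_itv p (f : R -> R) x : 0 < p -> a <= x <= b ->
  measurable_fun `[a, b] f ->
  (Gamma p)^-1 * \int[mu]_(t in `[a, x]) ((x - t) `^ (p - 1) * f t) =
  rlop p (f \_ `[a, b]) x.
Proof.
move=> p0 /andP[ax xb] mf.
have mfx : measurable_fun `[a, x] f.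
  by apply: measurable_funS mf => //; exact: subset_itvl.
have mk : measurable_fun `[a, x] (fun t => (x - t) `^ (p - 1) * f t).
  apply: measurable_funM => //; apply: measurable_funTS.
  by apply: (measurableT_comp (measurable_powR (p - 1))); exact: measurable_funB.
have mK : measurable_fun `[a, x] (fun t => (Gamma p)^-1 * ((x - t) `^ (p - 1) * f t)).
  exact: measurable_funM.
rewrite -Rintegral_gt0Zl ?invr_gt0 ?Gamma_gt0// /Rintegral.
(* The endpoint t = x is dropped: for p = 1 the power of 0 is 1 there, while the truncated kernel is
   0. *)
rewrite -integral_itv_bndo_bndc; last first.
  apply/measurable_EFinP; apply: measurable_funS mK => //.
  by apply: subset_itvl; rewrite bnd_simp.
rewrite integral_mkcond; congr fine; apply: eq_integral => t _.
rewrite !patchE !mem_setE !in_itv/= rlker.unlock /pospow.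
have [at_|ta]/= := leP a t; last by rewrite mulr0.
rewrite subr_gt0; have [tx|xt]/= := ltP t x; last by rewrite mulr0 mul0r.
by rewrite (ltW (lt_le_trans tx xb)) mulrA.
Qed.

Lemma within_continuous_rlop1 f : mu.-integrable `[a, b] (EFin \o f) ->
  {within `[a, b], continuous (rlop 1 (f \_ `[a, b]))}.
Proof.
move=> intf; have := parameterized_integral_continuous (ltW ab) intf.
apply: subspace_eq_continuous => x; rewrite inE/= in_itv/= => xab.
have /integrableP[/measurable_EFinP mf _] := intf.
rewrite /from_subspace -rlop_itv// Gamma1 invr1 mul1r subrr /parameterized_integral.
by apply: eq_Rintegral => t _; rewrite powRr0 mul1r.
Qed.

End extension.

(** * Smooth bump functions *)

Section bump.
Local Open Scope classical_set_scope.
Context {R : realType}.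
Local Notation mu := (@lebesgue_measure R).
Implicit Types (P Q : {poly R}) (y z x : R).

(* These functions of [y] are closed under derivation, whence smoothness. *)
Definition flat P y : R := if 0 < y then P.[y^-1] * expR (- y^-1) else 0.

(** With N the size of P, [|P.[z]|] is at most S z^N, while e^z is at least z^(N+2) / (N+2)!. The
    two spare powers become a factor y^2 under z = 1/y. *)
Lemma horner_expRN_le P : exists2 C, 0 <= C &
  forall z, 1 <= z -> `|P.[z]| * expR (- z) <= C / z ^+ 2.
Proof.
pose N := size P; pose S := \sum_(i < N) `|P`_i|.
have S0 : 0 <= S by apply: sumr_ge0.
exists (S * (N.+2)`!%:R); first by rewrite mulr_ge0.
move=> z z1; have z0 : 0 < z by exact: lt_le_trans z1.
have PS : `|P.[z]| <= S * z ^+ N.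
  rewrite horner_coef mulr_suml (le_trans (ler_norm_sum _ _ _))// ler_sum// => i _.
  rewrite normrM ler_wpM2l// normrX (ger0_norm (ltW z0)).
  exact: (ler_weXn2l z1 (ltnW (ltn_ord i))).
have Ez : z ^+ N.+2 / (N.+2)`!%:R <= expR z.
  by rewrite (le_trans _ (expR_ge1Dxn N.+1 (ltW z0)))// lerDr.
rewrite expRN ler_pdivrMr ?expR_gt0// (le_trans PS)// -!mulrA ler_wpM2l//.
rewrite -ler_pdivrMl ?ltr0n ?fact_gt0// mulrC -ler_pdivrMl ?invr_gt0 ?exprn_gt0//.
by rewrite invrK mulrA -exprD.
Qed.

Lemma flat_le P : exists2 C, 0 <= C & forall y, `|y| <= 1 -> `|flat P y| <= C * y ^+ 2.
Proof.
have [C C0 PC] := horner_expRN_le P; exists C => // y y1.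
rewrite /flat; case: ifPn => [y0|_]; last by rewrite normr0 mulr_ge0// sqr_ge0.
rewrite normrM (ger0_norm (expR_ge0 _)) (le_trans (PC _ _))//.
  by rewrite invf_ge1// (le_trans (ler_norm _)).
by rewrite exprVn invrK.
Qed.

Lemma flatN P y : flat (- P) y = - flat P y.
Proof. by rewrite /flat; case: ifP => _; rewrite ?oppr0// hornerN mulNr. Qed.

(** Chain rule for P(1/y) exp(-1/y), written as a polynomial in 1/y. *)
Definition dflat P := (P - P^`()) * 'X^2.

Lemma is_derive_flat P y : is_derive y 1 (flat P) (flat (dflat P) y).
Proof.
have [y0|y0|->] := ltgtP y 0.
- rewrite {2}/flat ltNge (ltW y0)/=.
  apply: (near_eq_is_derive (f := cst 0)).
  near=> z; rewrite /flat ltNge/= ltW//; near: z; exact: lt_nbhsl.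
- rewrite {2}/flat y0.
  apply: (near_eq_is_derive (f := (fun z => P.[z] * expR (- z)) \o (fun z => z^-1))).
    by near=> z; rewrite /flat ifT//; near: z; exact: lt_nbhsr.
  have DV : is_derive y 1 (fun z => z^-1) (- y ^- 2).
    apply: is_derive_eq; first by apply: is_deriveV; rewrite gt_eqF.
    by rewrite scaler1.
  have DE z : is_derive z 1 (fun z : R => expR (- z)) (- expR (- z)).
    have := is_derive1_comp (is_derive_expR (- z)) (is_deriveNid z 1).
    by rewrite mulrN1.
  have DP z : is_derive z 1 (fun z => P.[z] * expR (- z))
      ((P^`() - P).[z] * expR (- z)).
    apply: is_derive_eq; rewrite hornerD hornerN /GRing.scale /=; ring.
  have := is_derive1_comp (DP y^-1) DV.
  suff -> : (P^`() - P).[y^-1] * expR (- y^-1) * (- y ^- 2) =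
    (dflat P).[y^-1] * expR (- y^-1) by [].
  by rewrite /dflat hornerM hornerXn !hornerD !hornerN exprVn; ring.
- rewrite {2}/flat ltxx.
  have [C C0 fC] := flat_le P.
  have f0 : flat P 0 = 0 by rewrite /flat ltxx.
  (* By [flat_le] the difference quotient is at most C |h|; the bound on h uses [C + 1] because C
     may be 0. *)
  have cv : h^-1 *: ((flat P \o shift 0) (h *: 1) - flat P 0) @[h --> 0^'] --> 0.
    apply/cvgr0Pnorm_le => e e0; near=> h.
    rewrite f0 subr0 /= addr0 /GRing.scale/= mulr1 normrM normfV.
    have h0 : h != 0 by near: h; exact: nbhs_dnbhs_neq.
    have h1 : `|h| <= 1 by near: h; apply: dnbhs0_le.
    have hC : `|h| <= e / (C + 1) by near: h; apply: dnbhs0_le; rewrite divr_gt0// ltr_wpDl.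
    rewrite mulrC ler_pdivrMr ?normr_gt0// (le_trans (fC _ h1))//.
    rewrite -(real_normK (num_real h)) expr2 mulrA ler_wpM2r//.
    rewrite (le_trans (ler_wpM2l C0 hC))// mulrCA ler_piMr ?(ltW e0)//.
    by rewrite ler_pdivrMr ?ltr_wpDl// mul1r lerDl.
  by apply: DeriveDef; [apply/cvg_ex; exists 0|exact/cvg_lim].
Unshelve. all: by end_near. Qed.

(** The product rule turns a generator into a sum of two generators, so the class is stable under
    [derive1], and derivability of all iterates follows by induction. *)
Inductive bumps : (R -> R) -> Prop :=
| bumps_prod P Q p q : bumps (fun x => flat P (x - p) * flat Q (q - x))
| bumps_add f g : bumps f -> bumps g -> bumps (fun x => f x + g x).

Lemma bumps_derive f : bumps f ->
  (forall x, derivable f x 1) /\ bumps (derive1 f).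
Proof.
elim=> [P Q p q|{}f g bf [df bdf] bg [dg bdg]].
  have D x : is_derive x 1 (fun x => flat P (x - p) * flat Q (q - x))
    (flat (dflat P) (x - p) * flat Q (q - x) + flat P (x - p) * flat (- dflat Q) (q - x)).
    have D1 : is_derive x 1 (fun x => flat P (x - p)) (flat (dflat P) (x - p)).
      apply: is_derive_eq.
        apply: (@is_derive1_comp _ (flat P) (fun x => x - p)).
          exact: is_derive_flat.
      by rewrite subr0 mulr1.
    have D2 : is_derive x 1 (fun x => flat Q (q - x)) (flat (- dflat Q) (q - x)).
      apply: is_derive_eq.
        apply: (@is_derive1_comp _ (flat Q) (fun x => q - x)).
          exact: is_derive_flat.
      by rewrite flatN; ring.
    apply: is_derive_eq; rewrite /GRing.scale/=; ring.
  split; first by move=> x; have [] := D x.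
  have -> : derive1 (fun x => flat P (x - p) * flat Q (q - x)) = (fun x =>
    flat (dflat P) (x - p) * flat Q (q - x) + flat P (x - p) * flat (- dflat Q) (q - x)).
    by apply/funext => x; rewrite derive1E; have [_] := D x.
  by apply: bumps_add; exact: bumps_prod.
split; first by move=> x; exact: derivableD.
have -> : derive1 (fun x => f x + g x) = (fun x => derive1 f x + derive1 g x).
  by apply/funext => x; rewrite !derive1E deriveD.
exact: bumps_add.
Qed.

Lemma bumps_iter f : bumps f -> forall k x,
  derivable (iter k (fun f : R -> R => derive1 f) f) x 1.
Proof.
move=> bf k; move: f bf; elim: k => [|k IH] f bf x.
  by have [df _] := bumps_derive bf; exact: df.
by rewrite iterSr; apply: IH; have [] := bumps_derive bf.
Qed.

Lemma bumpsZ c f : bumps f -> bumps (fun x => c * f x).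
Proof.
elim=> [P Q p q|{}f g _ bf _ bg].
  have -> : (fun x => c * (flat P (x - p) * flat Q (q - x))) =
    (fun x => flat (c *: P) (x - p) * flat Q (q - x)).
    apply/funext => x; rewrite /flat; case: ifP => _; last by rewrite !mul0r mulr0.
    by rewrite hornerZ !mulrA.
  exact: bumps_prod.
have -> : (fun x => c * (f x + g x)) = (fun x => c * f x + c * g x).
  by apply/funext => x; rewrite mulrDr.
exact: bumps_add.
Qed.

Definition bump p q x : R := flat 1 (x - p) * flat 1 (q - x).

Lemma bump_gt0 p q x : p < x < q -> 0 < bump p q x.
Proof.
move=> /andP[px xq]; rewrite /bump /flat !subr_gt0 px xq !hornerC.
by rewrite !mul1r mulr_gt0 ?expR_gt0.
Qed.

Lemma bump_out p q x : ~~ (p < x < q) -> bump p q x = 0.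
Proof.
rewrite negb_and /bump /flat !subr_gt0 => /orP[/negbTE ->|/negbTE ->].
  by rewrite mul0r.
by rewrite mulr0.
Qed.

Lemma bump_ge0 p q x : 0 <= bump p q x.
Proof. by have [/bump_gt0/ltW //|/bump_out ->] := boolP (p < x < q). Qed.

Lemma bumps_bump p q : bumps (bump p q).
Proof. exact: bumps_prod. Qed.

Lemma continuous_bump p q : continuous (bump p q).
Proof.
by apply: derivable_continuous => x; have [+ _] := bumps_derive (bumps_bump p q); exact.
Qed.

Lemma integrable_bump p q : mu.-integrable setT (EFin \o bump p q).
Proof.
apply: (@integrable_supported _ `[p, q]%classic) => //.
  apply: continuous_compact_integrable; first exact: segment_compact.
  exact/continuous_subspaceT/continuous_bump.
move=> x /= nx; apply: bump_out; apply/negP => /andP[px xq]; apply: nx.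
by rewrite in_itv/= !ltW.
Qed.

Lemma Rintegral_bump_gt0 p q : p < q -> 0 < \int[mu]_x bump p q x.
Proof.
move=> pq; have ib := integrable_bump p q.
rewrite -lte_fin /Rintegral fineK; last exact: (integrable_fin_num _ ib).
apply: (@lt_le_trans _ _ (\int[mu]_(x in `]p, q[) (bump p q x)%:E)%E).
  apply: integral_gt0 => //.
  - by rewrite lebesgue_measure_itv/= lte_fin pq -EFinB eqe gt_eqF// subr_gt0.
  - have /integrableP[mb _] := ib; exact: measurable_funTS.
  - by move=> x /=; rewrite in_itv/= lte_fin => /bump_gt0.
apply: ge0_subset_integral => //.
  by have /integrableP[] := ib.
by move=> x _; rewrite lee_fin bump_ge0.
Qed.

End bump.

(** * The du Bois-Reymond lemma *)

Section du_bois_reymond.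
Local Open Scope classical_set_scope.
Context {R : realType}.
Local Notation mu := (@lebesgue_measure R).
Implicit Types (x y z p q : R).

(** The primitive taken from -oo vanishes to the left of c by the support of f and to the right of d
    because the total integral is 0. *)
Lemma bumps_primitive (f : R -> R) (c d : R) : bumps f -> c < d ->
  (forall x, ~~ (c < x < d) -> f x = 0) -> \int[mu]_x f x = 0 ->
  mu.-integrable setT (EFin \o f) ->
  exists phi : R -> R, [/\ derive1 phi = f,
    (forall k x, derivable (iter k (fun f : R -> R => derive1 f) phi) x 1) &
    forall x, x < c \/ d < x -> phi x = 0].
Proof.
move=> bf cd f0 If intf; have [df _] := bumps_derive bf.
pose phi x := \int[mu]_(t in `]-oo, x]) f t.
have D x : derivable phi x 1 /\ derive1 phi x = f x.
  apply: (@continuous_FTC1 _ f -oo%O x (x + 1)) => //.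
  - by rewrite ltrDl.
  - exact: integrableS intf.
  - exact: ltNyr.
  - exact: derivable_continuous.
have dphi : derive1 phi = f by apply/funext => x; have [] := D x.
exists phi; split => //.
  move=> [|k] x; first by have [] := D x.
  by rewrite iterSr dphi; exact: bumps_iter.
move=> x [xc|dx].
  rewrite /phi Rintegral_mkcond -[RHS](@Rintegral_set0 _ _ _ mu (fun=> 0)) [RHS]Rintegral_mkcond.
  apply: eq_Rintegral => t _; rewrite !patchE mem_setE in_itv/= in_set0.
  case: ifPn => // tx; apply: f0; rewrite negb_and -!leNgt.
  by rewrite (ltW (le_lt_trans tx xc)).
rewrite -If /phi Rintegral_mkcond; apply: eq_Rintegral => t _.
rewrite patchE mem_setE in_itv/=; case: ifPn => //; rewrite -ltNge => xt.
by rewrite f0// negb_and -!leNgt (ltW (lt_trans dx xt)) orbT.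
Qed.

(** Since x may be an endpoint, the subinterval lies beside x: to its right, or to its left when x =
    b. The fractions 1/3 and 1/2 keep it strictly inside []a, b[]. *)
Lemma exists_subitv (a b x e : R) : a < b -> a <= x <= b -> 0 < e ->
  exists p q, [/\ a < p, p < q, q < b & forall z, p < z < q -> `|x - z| < e].
Proof.
move=> ab /andP[ax xb] e0.
have [xb'|bx] := ltP x b.
  exists (x + Num.min e (b - x) / 3), (x + Num.min e (b - x) / 2).
  have m0 : 0 < Num.min e (b - x) by rewrite lt_min e0 subr_gt0.
  have me : Num.min e (b - x) <= e by rewrite ge_min lexx.
  have mb : Num.min e (b - x) <= b - x by rewrite ge_min lexx orbT.
  split; [lra|lra|lra|] => z /andP[pz zq].
  by rewrite ltr_norml; apply/andP; split; lra.
exists (b - Num.min e (b - a) / 2), (b - Num.min e (b - a) / 3).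
have m0 : 0 < Num.min e (b - a) by rewrite lt_min e0 subr_gt0.
have me : Num.min e (b - a) <= e by rewrite ge_min lexx.
have mb : Num.min e (b - a) <= b - a by rewrite ge_min lexx orbT.
split; [lra|lra|lra|] => z /andP[pz zq].
by rewrite ltr_norml; apply/andP; split; lra.
Qed.

(* Two bumps of opposite mass, near [x] and near [y], have a compactly supported
   smooth primitive to test against. *)
Lemma du_bois_reymond_le (a b M : R) (H : R -> R) : a < b -> continuous H ->
  (forall x, `|H x| <= M) ->
  (forall phi, test_fun a b phi -> \int[mu]_x (H x * derive1 phi x) = 0) ->
  forall x y, a <= x <= b -> a <= y <= b -> H y <= H x.
Proof.
move=> ab cH HM H0 x y xab yab; rewrite leNgt; apply/negP => Hxy.
pose e := (H y - H x) / 3.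
have e0 : 0 < e by rewrite divr_gt0 ?subr_gt0.
have near_ball z : exists2 d, 0 < d & forall t, `|z - t| < d -> `|H z - H t| < e.
  have /cvgrPdist_lt /(_ _ e0) := cH z.
  by move=> /nbhs_ballP[d d0 zd]; exists d.
have [dx dx0 Hx] := near_ball x; have [dy dy0 Hy] := near_ball y.
have [p [q [ap pq qb pqx]]] := exists_subitv ab xab dx0.
have [p' [q' [ap' pq' qb' pqy]]] := exists_subitv ab yab dy0.
pose c := \int[mu]_z bump p q z; pose c' := \int[mu]_z bump p' q' z.
have c0 : 0 < c by exact: Rintegral_bump_gt0.
have c'0 : 0 < c' by exact: Rintegral_bump_gt0.
pose f z := c' * bump p q z + (- c) * bump p' q' z.
have bf : bumps f by apply: bumps_add; apply: bumpsZ; exact: bumps_bump.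
have ibZ k r s : mu.-integrable setT (EFin \o (fun z => k * bump r s z)).
  exact: (integrableZl measurableT k (integrable_bump r s)).
have intf : mu.-integrable setT (EFin \o f).
  exact: (integrableD measurableT (ibZ c' p q) (ibZ (- c) p' q')).
have If : \int[mu]_z f z = 0.
  rewrite RintegralD//; try exact: ibZ.
  rewrite !RintegralZl//; try exact: integrable_bump.
  by rewrite -/c -/c'; ring.
pose lo := Num.min p p'; pose hi := Num.max q q'.
have f0 z : ~~ (lo < z < hi) -> f z = 0.
  rewrite /lo /hi gt_min lt_max => nz; rewrite /f !bump_out ?mulr0 ?addr0//.
    by apply: contra nz => /andP[-> ->]; rewrite !orbT.
  by apply: contra nz => /andP[-> ->].
have lohi : lo < hi by rewrite /lo /hi gt_min !lt_max pq.
have [phi [dphi sphi phi0]] := bumps_primitive bf lohi f0 If intf.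
have tphi : test_fun a b phi.
  split => //; exists lo, hi; split => //.
  - by rewrite lt_min ap.
  - by rewrite gt_max qb.
have := H0 _ tphi; rewrite dphi.
have iHb r s : mu.-integrable setT (EFin \o (fun z => H z * bump r s z)).
  apply: le_integrable (integrableZl measurableT M (integrable_bump r s)) => //.
    apply/measurable_EFinP; apply: measurable_funM.
      exact: continuous_measurable_fun.
    by apply: continuous_measurable_fun; exact: continuous_bump.
  move=> z _ /=; rewrite lee_fin !normrM ler_wpM2r//.
  by rewrite (le_trans (HM z))// ler_norm.
have iHbZ k r s : mu.-integrable setT (EFin \o (fun z => k * (H z * bump r s z))).
  exact: (integrableZl measurableT k (iHb r s)).
have -> : \int[mu]_z (H z * f z) =
    c' * \int[mu]_z (H z * bump p q z) - c * \int[mu]_z (H z * bump p' q' z).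
  rewrite -mulNr -!RintegralZl// -RintegralD//.
  by apply: eq_Rintegral => z _; rewrite /f; ring.
have E1 : \int[mu]_z (H z * bump p q z) <= (H x + e) * c.
  rewrite -RintegralZl//; last exact: integrable_bump.
  apply: le_Rintegral => // z _.
  have [pzq|nz] := boolP (p < z < q); last by rewrite bump_out// !mulr0.
  rewrite ler_wpM2r ?bump_ge0//.
  by have := Hx _ (pqx _ pzq); rewrite ltr_norml => /andP[]; lra.
have E2 : (H y - e) * c' <= \int[mu]_z (H z * bump p' q' z).
  rewrite -RintegralZl//; last exact: integrable_bump.
  apply: le_Rintegral => // z _.
  have [pzq|nz] := boolP (p' < z < q'); last by rewrite bump_out// !mulr0.
  rewrite ler_wpM2r ?bump_ge0//.
  by have := Hy _ (pqy _ pzq); rewrite ltr_norml => /andP[]; lra.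
apply/eqP; rewrite lt_eqF//.
apply: (@le_lt_trans _ _ (c' * ((H x + e) * c) - c * ((H y - e) * c'))).
  by apply: lerB; [exact: (ler_wpM2l (ltW c'0))|exact: (ler_wpM2l (ltW c0))].
suff neg (r r' u v w : R) : 0 < r -> 0 < r' -> 0 < w -> v = u + 3 * w ->
    r' * ((u + w) * r) - r * ((v - w) * r') < 0.
  by apply: neg => //; rewrite /e; field.
move=> r0 r'0 w0 ->.
rewrite (_ : r' * _ - _ = - (r * r' * w)); last by ring.
by rewrite oppr_lt0 !mulr_gt0.
Qed.

Lemma du_bois_reymond (a b M : R) (H : R -> R) : a < b -> continuous H ->
  (forall x, `|H x| <= M) ->
  (forall phi, test_fun a b phi -> \int[mu]_x (H x * derive1 phi x) = 0) ->
  forall x y, a <= x <= b -> a <= y <= b -> H x = H y.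
Proof.
move=> ab cH HM H0 x y xab yab; apply/eqP; rewrite eq_le.
by rewrite !(du_bois_reymond_le ab cH HM H0).
Qed.

End du_bois_reymond.

(** * Primitives of distributions and the action of J^p on them *)

Section primitives.
Local Open Scope classical_set_scope.
Context {R : realType}.
Local Notation mu := (@lebesgue_measure R).
Variables a b : R.
Hypothesis ab : a < b.
Implicit Types (F G : R -> R) (f g : @distr R) (x t : R).

Let aab : a <= a <= b. Proof. by rewrite lexx ltW. Qed.

Lemma clamp_C0 F t : C0 a b F -> t <= a -> clamp a b F t = 0.
Proof. by move=> [_ Fa] ta; rewrite clamp_le. Qed.

Lemma eq_clamp F G : (forall x, a <= x <= b -> F x = G x) -> clamp a b F = clamp a b G.
Proof. by move=> FG; apply/funext => x; rewrite /clamp FG// clamp_itv. Qed.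

Lemma measurable_clamp F : C0 a b F -> measurable_fun setT (clamp a b F).
Proof. by move=> [cF _]; apply: continuous_measurable_fun; exact: continuous_clamp. Qed.

Lemma eq_C0 F G : (forall x, a <= x <= b -> F x = G x) -> C0 a b F -> C0 a b G.
Proof.
move=> FG [cF Fa]; split; last by rewrite -FG.
apply: subspace_eq_continuous cF => x; rewrite inE/= in_itv/= => xab.
by rewrite /from_subspace FG.
Qed.

Lemma regd_eq F G : (forall x, a <= x <= b -> F x = G x) -> regd a b F = regd a b G.
Proof.
move=> FG; apply/funext => phi; apply: eq_Rintegral => x.
by rewrite inE/= in_itv/= => /andP[ax xb]; rewrite FG// !ltW.
Qed.

Lemma eq_primitive_of F G f : (forall x, a <= x <= b -> F x = G x) ->
  primitive_of a b F f -> primitive_of a b G f.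
Proof.
move=> FG [CF Ff]; split; first exact: eq_C0 CF.
by rewrite -(regd_eq FG).
Qed.

Lemma primitive_of_deq F f g : primitive_of a b F f -> primitive_of a b F g ->
  deq a b f g.
Proof. by move=> [_ Ff] [_ Fg] phi tphi; rewrite -Ff// Fg. Qed.

Lemma integrable_within F : {within `[a, b], continuous F} ->
  mu.-integrable `[a, b] (EFin \o F).
Proof. by move=> cF; apply: continuous_compact_integrable => //; exact: segment_compact. Qed.

Lemma integrable_within_test F phi : {within `[a, b], continuous F} ->
  test_fun a b phi -> mu.-integrable `]a, b[ (EFin \o (fun x => F x * phi x)).
Proof.
move=> cF tphi.
have : mu.-integrable `[a, b] (EFin \o (fun x => F x * phi x)).
  apply: integrable_within => x; apply: (@continuousM _ (subspace `[a, b]) F phi x).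
    exact: cF.
  have cphi : {within `[a, b], continuous phi}.
    exact: (continuous_subspaceT (test_fun_continuous tphi)).
  exact: cphi.
by apply: integrableS => //; exact: subset_itv_oo_cc.
Qed.

(** The clamped difference annihilates derivatives of test functions, hence is constant on [[a, b]],
    and it vanishes at a. *)
Lemma primitive_unique F G f : primitive_of a b F f -> primitive_of a b G f ->
  forall x, a <= x <= b -> F x = G x.
Proof.
move=> [[cF Fa] Ff] [[cG Ga] Gf].
pose H := clamp a b (fun x => F x - G x).
have cFG : {within `[a, b], continuous (fun x => F x - G x)}.
  by move=> x; apply: continuousB; [exact: cF|exact: cG].
have [M HM] := clamp_bounded ab cFG.
have H0 phi : test_fun a b phi -> \int[mu]_x (H x * derive1 phi x) = 0.
  move=> tphi; have tphi' := test_fun_derive1 tphi.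
  rewrite -(Rintegral_test_fun H tphi').
  have -> : \int[mu]_(x in `]a, b[) (H x * derive1 phi x) =
      \int[mu]_(x in `]a, b[) (F x * derive1 phi x - G x * derive1 phi x).
    apply: eq_Rintegral => x; rewrite inE/= in_itv/= => /andP[ax xb].
    by rewrite /H clamp_id ?(ltW ax) ?(ltW xb)// mulrBl.
  rewrite RintegralB//; try exact: integrable_within_test.
  have := Ff _ tphi; rewrite -(Gf _ tphi) /Dd /regd => /oppr_inj ->.
  by rewrite subrr.
move=> x xab.
have := du_bois_reymond ab (continuous_clamp ab cFG) HM H0 xab aab.
by rewrite !clamp_id// Fa Ga subrr => /eqP; rewrite subr_eq0 => /eqP.
Qed.

Lemma rlop_le0 p F x : (forall t, t < x -> F t = 0) -> rlop p F x = 0.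
Proof.
move=> F0; rewrite (eq_rlop p (g := fun=> 0))// /rlop.
by rewrite /Rintegral integral0_eq// => t _; rewrite mulr0.
Qed.

Lemma patch_lt0 F t : t < a -> (F \_ `[a, b]) t = 0.
Proof. by move=> ta; rewrite patchE mem_setE in_itv/= leNgt ta. Qed.

Lemma integrable_patch F : mu.-integrable `[a, b] (EFin \o F) ->
  mu.-integrable setT (EFin \o (F \_ `[a, b])).
Proof.
move=> iF; apply: (@integrable_supported _ `[a, b]%classic) => //.
  apply: eq_integrable iF => // x xab; rewrite /= patchE.
  by move: xab => ->.
by move=> x nx; rewrite patchE memNset.
Qed.

Lemma primitive_of_regd F G : mu.-integrable `[a, b] (EFin \o F) ->
  (forall x, a <= x <= b -> rlop 1 (F \_ `[a, b]) x = G x) ->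
  primitive_of a b G (regd a b F).
Proof.
move=> iF FG; apply: (eq_primitive_of FG); split.
  split; first exact: within_continuous_rlop1.
  by apply: rlop_le0 => t ta; rewrite patch_lt0.
move=> phi tphi; rewrite /Dd /regd rlop1_parts//; last exact: integrable_patch.
rewrite opprK; apply: eq_Rintegral => x /set_mem/subset_itv_oo_cc xab.
by rewrite patchE mem_set.
Qed.

Lemma primitive_of_prim f : HK a b f -> primitive_of a b (prim a b f) f.
Proof. by move=> [F Ff]; rewrite /prim; case: xgetP => // /(_ F). Qed.

(* The action of the fractional integral on primitives. *)
Definition rlfrac (p : R) F : R -> R := if p <= 0 then F else rlop p (clamp a b F).

Lemma rlfracE p F : 0 < p -> rlfrac p F = rlop p (clamp a b F).
Proof. by rewrite /rlfrac ltNge => /negbTE ->. Qed.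

Lemma integrable_rlker_clamp p F x : 0 < p -> C0 a b F ->
  mu.-integrable setT (fun t => (rlker p (x - t) * clamp a b F t)%:E).
Proof.
move=> p0 CF; have [M FM] := clamp_bounded ab CF.1.
exact: (integrable_rlker_bounded x p0 (measurable_clamp CF)
  (fun t => @clamp_C0 F t CF) FM).
Qed.

Lemma rlfrac_C0 p F : C0 a b F -> C0 a b (rlfrac p F).
Proof.
move=> CF; rewrite /rlfrac; case: ifPn => // ; rewrite -ltNge => p0; split.
  have [M FM] := clamp_bounded ab CF.1.
  apply: continuous_subspaceT.
  exact: (continuous_rlop p0 (continuous_clamp ab CF.1)
    (fun t => @clamp_C0 F t CF) FM).
by apply: rlop_le0 => t /ltW ta; rewrite clamp_C0.
Qed.

Lemma rlop_clamp_rlop p q F x : C0 a b F -> 0 < q -> x <= b ->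
  rlop p (clamp a b (rlop q (clamp a b F))) x = rlop p (rlop q (clamp a b F)) x.
Proof.
move=> CF q0 xb; apply: eq_rlop => t tx.
have z y : y <= a -> rlop q (clamp a b F) y = 0.
  by move=> ya; apply: rlop_le0 => s sy; rewrite clamp_C0// ltW// (lt_le_trans sy).
have [at_|ta] := leP a t; last by rewrite clamp_le ?(ltW ta)// !z// ltW.
by rewrite clamp_id// at_ (ltW (lt_le_trans tx xb)).
Qed.

Lemma rlfrac_comp p q F x : 0 <= p -> 0 <= q -> C0 a b F -> a <= x <= b ->
  rlfrac p (rlfrac q F) x = rlfrac (p + q) F x.
Proof.
rewrite le_eqVlt => /predU1P[<- _ _ _|p0]; first by rewrite add0r {1}/rlfrac lexx.
rewrite le_eqVlt => /predU1P[<- _ _|q0 CF /andP[_ xb]].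
  by rewrite addr0 {2}/rlfrac lexx.
rewrite /rlfrac !leNgt p0 q0 addr_gt0//= rlop_clamp_rlop// rlop_comp//.
  exact: measurable_clamp.
by apply: integrable_rlker_clamp => //; exact: addr_gt0.
Qed.

Lemma primitive_of_rlfrac1 p F : 0 <= p -> C0 a b F ->
  primitive_of a b (rlfrac (p + 1) F) (regd a b (rlfrac p F)).
Proof.
move=> p0 CF; have [cF' F'a] := rlfrac_C0 p CF.
apply: primitive_of_regd; first exact: integrable_within.
move=> x xab; rewrite -rlop_clamp//; last by case/andP: xab.
by rewrite -(@rlfracE 1 (rlfrac p F) ltr01) rlfrac_comp// addrC.
Qed.

Lemma primitive_of_Dd F f : C0 a b F -> deq a b f (regd a b F) ->
  primitive_of a b F (Dd f).
Proof.
move=> CF fF; split => // phi tphi; rewrite /Dd fF//.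
exact: test_fun_derive1.
Qed.

(** A distribution with primitive J^(r+1) F agrees on test functions with the function J^r F, so its
    derivative has primitive J^r F: each [Dd] lowers the order by one. *)
Lemma primitive_of_Dn m p F f : 0 <= p -> C0 a b F ->
  primitive_of a b (rlfrac (m%:R + p) F) f -> primitive_of a b (rlfrac p F) (Dn m f).
Proof.
move=> p0 CF; elim: m f => [|m IH] f; first by rewrite add0r.
rewrite -natr1 addrAC => Ff; rewrite /Dn iterSr; apply: IH.
have mp0 : 0 <= m%:R + p by rewrite addr_ge0.
apply: primitive_of_Dd; first exact: rlfrac_C0.
exact: primitive_of_deq Ff (primitive_of_rlfrac1 mp0 CF).
Qed.

Lemma L1_patch (F : R -> R) p x : 1 <= p -> L1 a b F ->
  mu.-integrable setT (fun t => (rlker p (x - t) * (F \_ `[a, b]) t)%:E).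
Proof.
move=> p1 /integrable_patch iF; exact: (integrable_rlker_ge1 x p1 iF (fun t => @patch_lt0 F t)).
Qed.

Lemma integrable_rlop_patch p F : 0 < p -> L1 a b F ->
  mu.-integrable `[a, b] (EFin \o rlop p (F \_ `[a, b])).
Proof.
move=> p0 LF; have iF := integrable_patch LF.
have /integrableP[/measurable_EFinP mF _] := iF.
have p1 : 1 <= 1 + p by rewrite lerDl ltW.
(* Seen from the point b + 1, the order 1 kernel equals 1 on all of [[a, b]]. *)
have := integrable_rlop_comp ltr01 p0 mF (L1_patch (b + 1) p1 LF).
move=> iR; have : mu.-integrable `[a, b]
    (fun s => (rlker 1 (b + 1 - s) * rlop p (F \_ `[a, b]) s)%:E).
  exact: integrableS iR.
apply: eq_integrable => // x; rewrite inE/= in_itv/= => /andP[_ xb].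
by rewrite rlker1 subr_gt0 (le_lt_trans xb) ?ltrDl// mul1r.
Qed.

Lemma primitive_of_rlop_L1 p F U : 0 < p -> L1 a b F ->
  primitive_of a b U (regd a b F) ->
  primitive_of a b (rlfrac p U) (regd a b (fun x =>
    (Gamma p)^-1 * \int[mu]_(t in `[a, x]) ((x - t) `^ (p - 1) * F t))).
Proof.
move=> p0 LF UF.
have iF := integrable_patch LF.
have /integrableP[/measurable_EFinP mFT _] := iF.
have /integrableP[/measurable_EFinP mF _] := LF.
have FU : forall x, a <= x <= b -> rlop 1 (F \_ `[a, b]) x = U x.
  exact: (primitive_unique (primitive_of_regd LF (fun x _ => erefl)) UF).
rewrite (@regd_eq _ (rlop p (F \_ `[a, b]))); last first.
  by move=> x xab; exact: rlop_itv.
apply: primitive_of_regd; first exact: integrable_rlop_patch.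
move=> x xab; have /andP[_ xb] := xab.
transitivity (rlop 1 (rlop p (F \_ `[a, b])) x).
  apply: eq_rlop => t tx; rewrite patchE; case: ifPn => //.
  rewrite mem_setE in_itv/= (ltW (lt_le_trans tx xb)) andbT -ltNge => ta.
  by rewrite rlop_le0// => s st; apply: patch_lt0; exact: lt_trans ta.
(* The orders 1 and p are exchanged through 1 + p >= 1, where the L^1 function is integrable against
   the kernel for every x. *)
rewrite rlop_comp//; last by apply: L1_patch => //; rewrite lerDl ltW.
rewrite addrC -rlop_comp//; last by apply: L1_patch => //; rewrite lerDr ltW.
rewrite rlfracE//; apply: eq_rlop => t tx; have [at_|ta] := leP a t.
  by rewrite clamp_id ?FU// at_ (ltW (lt_le_trans tx xb)).
rewrite clamp_le ?(ltW ta)// UF.1.2 rlop_le0// => s st.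
by apply: patch_lt0; exact: lt_trans ta.
Qed.

Lemma rlfrac_le p F G (e : R) : 0 < p -> C0 a b F -> C0 a b G ->
  (forall x, a <= x <= b -> `|F x - G x| <= e) ->
  forall x, a <= x <= b -> `|rlfrac p F x - rlfrac p G x| <= e * rlker (p + 1) (b - a).
Proof.
move=> p0 CF CG FG x /andP[ax xb]; rewrite !rlfracE//.
have e0 : 0 <= e by apply: le_trans (FG a aab).
apply: (@le_trans _ _ (e * rlker (p + 1) (x - a))).
  apply: rlop_le => //; try exact: integrable_rlker_clamp.
    by move=> t ta; rewrite !clamp_C0.
  by move=> t _; rewrite /clamp FG// clamp_itv.
by rewrite ler_wpM2l// rlker_le ?lerD2r// lerDr ltW.
Qed.

(** Uniform continuity in which y may leave [[a, b]], because Steklov means at points near a reach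
    to the left of a. *)
Lemma heine F (e : R) : continuous F -> 0 < e -> exists2 d, 0 < d &
  forall x y, a <= x <= b -> `|x - y| < d -> `|F x - F y| <= e.
Proof.
move=> cF e0; have /compact_near_coveringP := @segment_compact R a b.
move=> /(_ R (0^'+) (fun d x => forall y, `|x - y| < d -> `|F x - F y| <= e) _).
have Fx x : `[a, b]%classic x -> \forall x' \near x & d \near 0^'+,
    forall y, `|x' - y| < d -> `|F x' - F y| <= e.
  move=> _; have e2 : 0 < e / 2 by rewrite divr_gt0.
  have /cvgrPdist_lt /(_ _ e2) /nbhs_ballP[r /= r0 xr] := cF x.
  have r2 : 0 < r / 2 by rewrite divr_gt0.
  exists (ball x (r / 2), [set d | d < r / 2]).
    split; first exact: nbhsx_ballx.
    exact: nbhs_right_lt.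
  move=> [x' d] [/= xx' dr] y yd.
  have x'r : ball x r x' by apply: le_ball xx'; rewrite ler_pdivrMr// ler_pMr// ler1n.
  have yr : ball x r y.
    move: xx'; rewrite /ball/= => xx'; rewrite (_ : x - y = (x - x') + (x' - y)); last by ring.
    by rewrite (le_lt_trans (ler_normD _ _))//; lra.
  have := xr _ x'r; have := xr _ yr => /= Fy Fx'.
  rewrite (_ : F x' - F y = (F x - F y) - (F x - F x')); last by ring.
  by rewrite (le_trans (ler_normB _ _))//; lra.
move=> /(_ Fx) Hd.
have [d [d0 dH]] := filter_ex (filterI (nbhs_right_gt (0 : R)) Hd).
by exists d => // x y xab; apply: dH; rewrite /= in_itv.
Qed.

End primitives.

(** * Fractional integrals and derivatives of distributions *)

Section fractional_integral.
Local Open Scope classical_set_scope.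
Context {R : realType}.
Local Notation mu := (@lebesgue_measure R).
Variables a b : R.
Hypothesis ab : a < b.
Implicit Types (F G : R -> R) (f g : @distr R) (x t p : R).

(* The approximants have the Steklov means of [F] as primitives. *)
Lemma L1_dense F f : primitive_of a b F f -> exists fk : nat -> R -> R,
  (forall k, L1 a b (fk k)) /\ alex_cvg a b (fun k => regd a b (fk k)) f.
Proof.
move=> Ff; have CF := Ff.1; pose Gt := clamp a b F.
have cG : continuous Gt by apply: continuous_clamp => //; exact: CF.1.
have G0 t : t <= a -> Gt t = 0 by exact: clamp_C0.
pose Phi y := \int[mu]_(t in `]-oo, y]) Gt t.
have iG u : mu.-integrable `]-oo, u] (EFin \o Gt).
  have : mu.-integrable `]-oo, u] (fun t => (rlker 1 (u + 1 - t) * Gt t)%:E).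
    by have := integrable_rlker_clamp ab (u + 1) ltr01 CF; exact: integrableS.
  apply: eq_integrable => // t; rewrite inE/= in_itv/= => tu.
  by rewrite rlker1 subr_gt0 (le_lt_trans tu) ?ltrDl// mul1r.
have dPhi (y : R) : is_derive y 1 Phi (Gt y).
  have [|d <-] := @continuous_FTC1 _ Gt -oo%O y (y + 1) _ (iG _) (ltNyr y) (cG y).
    by rewrite ltrDl.
  by rewrite derive1E; exact: derivableP.
have Phi0 y : y <= a -> Phi y = 0.
  move=> ya; rewrite /Phi /Rintegral integral0_eq// => t /=; rewrite in_itv/= => ty.
  by rewrite G0// (le_trans ty).
pose h k : R := k.+1%:R^-1.
have h0 k : 0 < h k by rewrite invr_gt0.
pose fk k x := k.+1%:R * (Gt x - Gt (x - h k)).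
pose U k x := k.+1%:R * (Phi x - Phi (x - h k)).
have dU k (x : R) : is_derive x 1 (U k) (fk k x).
  have d1 : is_derive x 1 (fun x => Phi (x - h k)) (Gt (x - h k)).
    have d2 : is_derive x 1 (fun x : R => x - h k) 1.
      by apply: is_derive_eq; rewrite subr0.
    have := @is_derive1_comp _ Phi (fun x => x - h k) x _ _ (dPhi _) d2.
    by rewrite mulr1.
  have d3 : is_derive x 1 (fun x => Phi x - Phi (x - h k)) (Gt x - Gt (x - h k)).
    exact: is_deriveB.
  exact: is_deriveZ.
have dUE k : derive1 (U k) = fk k.
  by apply/funext => x; rewrite derive1E; have [] := dU k x.
have cfk k : continuous (fk k).
  move=> x; apply: (@continuousM _ R^o (cst k.+1%:R) (fun x => Gt x - Gt (x - h k))).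
    exact: cst_continuous.
  apply: continuousB; first exact: cG.
  apply: (@continuous_comp _ _ _ (fun y => y - h k) Gt); last exact: cG.
  by apply: continuousB => //; exact: cst_continuous.
have Lfk k : L1 a b (fk k).
  by apply: integrable_within; exact: continuous_subspaceT.
have Ua k : U k a = 0.
  by rewrite /U !Phi0 ?subrr ?mulr0// gerBl ltW.
have Ufk k : primitive_of a b (U k) (regd a b (fk k)).
  apply: (primitive_of_regd ab (Lfk k)) => x xab.
  have /integrableP[/measurable_EFinP mfk _] := Lfk k.
  rewrite -rlop_itv// Gamma1 invr1 mul1r subrr.
  under eq_Rintegral do rewrite powRr0 mul1r.
  have /andP[+ _] := xab; rewrite le_eqVlt => /predU1P[<-|ax].
    by rewrite set_itv1 Rintegral_set1 Ua.
  rewrite -[RHS]subr0 -(Ua k) -Rintegral_derive1//; first by rewrite dUE.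
  by rewrite dUE; exact: cfk.
exists fk; split => //; exists U, F; split => // e e0.
have [d d0 dH] := heine a b cG e0.
exists (Num.truncn d^-1) => k kN x xab.
have hd : h k < d.
  rewrite /h invf_plt ?posrE// (lt_le_trans (truncnS_gt _))// ler_nat.
  by rewrite ltnS.
have xh : x - h k < x by rewrite gtrBl.
have cPhi : continuous Phi by apply: derivable_continuous => y; have [] := dPhi y.
have [c] := MVT xh (fun y _ => dPhi y) (continuous_subspaceT cPhi).
rewrite in_itv/= => /andP[xc cx] E.
have -> : U k x = Gt c.
  rewrite /U E (_ : x - (x - h k) = h k); last by ring.
  by rewrite mulrC -mulrA /h mulVf ?mulr1// pnatr_eq0.
rewrite -(clamp_id F xab) distrC; apply: dH => //.
by rewrite ger0_norm ?subr_ge0 ?ltW//; lra.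
Qed.

(** For p > 1 both boundary terms vanish, and differentiating the power yields a factor p - 1 that
    turns 1/Gamma(p) into 1/Gamma(p - 1). *)
Lemma HKmul_powR F f p x : primitive_of a b F f -> 1 <= p -> a <= x <= b ->
  (Gamma p)^-1 * HKmul a b x f (fun t => (x - t) `^ (p - 1)) = rlfrac a b (p - 1) F x.
Proof.
move=> Ff p1 xab; have Hf : HK a b f by exists F.
have prF := primitive_unique ab (primitive_of_prim Hf) Ff.
have aab : a <= a <= b by rewrite lexx ltW.
rewrite /HKmul (prF a aab) Ff.1.2 mul0r subr0 (prF x xab) subrr.
(* At p = 1 the power is the constant 1, also at 0: the boundary term F x survives and the integral
   vanishes. *)
have [->|p1'] := eqVneq p 1.
  rewrite subrr Gamma1 invr1 mul1r powRr0 mulr1 /rlfrac lexx.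
  rewrite (_ : \int[mu]_(t in _) _ = 0) ?subr0// /Rintegral integral0_eq// => t _.
  rewrite (_ : (fun t => (x - t) `^ 0) = cst 1); last first.
    by apply/funext => u; rewrite powRr0.
  by rewrite derive1_cst mulr0.
have q0 : 0 < p - 1 by rewrite subr_gt0 lt_neqAle eq_sym p1' p1.
have /andP[ax xb] := xab.
rewrite powR0 ?gt_eqF// mulr0 sub0r.
pose K t := (p - 1) * ((x - t) `^ (p - 1 - 1) * F t).
have CF := Ff.1.
have mF : measurable_fun `[a, b] F.
  by have /integrableP[/measurable_EFinP] := integrable_within CF.1.
have mK : measurable_fun `[a, x] (fun t => (x - t) `^ (p - 1 - 1) * F t).
  apply: measurable_funM; last first.
    by apply: measurable_funS mF => //; apply: subset_itvl.
  apply: measurable_funTS; apply: (measurableT_comp (measurable_powR (p - 1 - 1))).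
  exact: measurable_funB.
have mK' : measurable_fun `[a, x[ K.
  apply: measurable_funM => //; apply: measurable_funS mK => //.
  by apply: subset_itvl; rewrite bnd_simp.
pose H t := prim a b f t * derive1 (fun t => (x - t) `^ (p - 1)) t.
have HK' : {in `[a, x[%classic, H =1 (fun t => - K t)}.
  move=> t; rewrite inE/= in_itv/= => /andP[at_ tx].
  rewrite /H /K prF ?at_ ?(ltW (lt_le_trans tx xb))//.
  have xt : 0 < x - t by rewrite subr_gt0.
  have dpow : is_derive (x - t) 1 (fun u => u `^ (p - 1)) ((p - 1) * (x - t) `^ (p - 1 - 1)).
    have := @powR_derive1 _ (p - 1) (x - t); rewrite in_itv/= xt => /(_ isT) <-.
    by rewrite derive1E; apply: derivableP; apply: derivable_powR; rewrite in_itv/= xt.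
  have dsub : is_derive t 1 (fun u => x - u) (- 1).
    by apply: is_derive_eq; ring.
  have := @is_derive1_comp _ (fun u => u `^ (p - 1)) (fun u => x - u) t _ _ dpow dsub.
  rewrite derive1E => -[_ ->]; ring.
have -> : \int[mu]_(t in `[a, x]) H t = - \int[mu]_(t in `[a, x]) K t.
  (* [HK'] holds only for t < x; the endpoint, where the power may fail to be differentiable, is a
     null set. *)
  rewrite /Rintegral -integral_itv_bndo_bndc; last first.
    apply/measurable_EFinP; apply: (eq_measurable_fun (fun t => - K t)).
      by move=> t /HK' ->.
    exact: measurableT_comp mK'.
  rewrite -[in RHS]integral_itv_bndo_bndc; last exact/measurable_EFinP.
  rewrite -/(Rintegral _ _ _) -/(Rintegral _ _ _) -RintegralN_measurable//.
  by apply: eq_Rintegral => t /HK'.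
rewrite opprK Rintegral_gt0Zl//.
have -> : (Gamma p)^-1 = (Gamma (p - 1))^-1 / (p - 1).
  by have := GammaS q0; rewrite subrK => ->; rewrite invfM mulrC.
rewrite -mulrA mulKf ?gt_eqF// (rlop_itv q0 xab mF).
by rewrite rlfracE// (rlop_clamp ab _ CF.2 xb).
Qed.

Lemma primitive_of_RLint F f p : 0 <= p -> primitive_of a b F f ->
  primitive_of a b (rlfrac a b p F) (RLint a b p f).
Proof.
move=> p0 Ff; have CF := Ff.1.
rewrite /RLint; case: ifPn => [p_le0|]; first by rewrite /rlfrac p_le0.
rewrite -ltNge => {}p0; case: ifPn => [p1|].
  rewrite (@regd_eq _ _ _ _ (rlfrac a b (p - 1) F)); last first.
    by move=> x xab; exact: HKmul_powR.
  have := @primitive_of_rlfrac1 _ _ _ ab (p - 1) F; rewrite subrK; apply => //.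
  by rewrite subr_ge0.
rewrite -ltNge => p1.
set P := (X in xget _ X).
have Cp := rlfrac_C0 ab p CF.
have CVG (fk : nat -> R -> R) : (forall k, L1 a b (fk k)) ->
    alex_cvg a b (fun k => regd a b (fk k)) f ->
    exists2 U : nat -> R -> R, (forall k, primitive_of a b (U k) (regd a b (fun x =>
      (Gamma p)^-1 * \int[mu]_(t in `[a, x]) ((x - t) `^ (p - 1) * fk k t)))) &
    forall e : R, 0 < e -> exists N : nat, forall k : nat, (N <= k)%N ->
        forall x, a <= x <= b -> `|U k x - rlfrac a b p F x| <= e.
  move=> Lfk [U [V [Uk Vf UV]]].
  exists (fun k => rlfrac a b p (U k)); first by move=> k; exact: primitive_of_rlop_L1.
  move=> e e0; pose C := rlker (p + 1) (b - a).
  have C0 : 0 <= C by rewrite rlker_ge0// addr_gt0.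
  have eC0 : 0 < e / (C + 1) by rewrite divr_gt0// ltr_wpDl.
  have [N UVN] := UV _ eC0; exists N => k /UVN UVk x xab.
  apply: (@le_trans _ _ (e / (C + 1) * C)).
    apply: rlfrac_le => //; first exact: (Uk k).1.
    by move=> y yab; rewrite -(primitive_unique ab Vf Ff yab) UVk.
  rewrite mulrAC -mulrA ler_piMr ?(ltW e0)//.
  by rewrite ler_pdivrMr ?ltr_wpDl// mul1r lerDl.
have Pex : P (Dd (regd a b (rlfrac a b p F))).
  split; first by exists (rlfrac a b p F); split.
  move=> fk Lfk fkf; have [U Uk Ucvg] := CVG fk Lfk fkf.
  by exists U, (rlfrac a b p F); split => //; split.
have [Hh Ph] : P (xget (fun=> 0) P) by apply: xgetPex; exists (Dd (regd a b (rlfrac a b p F))).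
(* The chosen distribution is known only through approximating sequences. Along this one the
   primitives converge both to its primitive [V'] and to J^p F, which must then coincide. *)
have [fk [Lfk fkf]] := L1_dense Ff.
have [U Uk Ucvg] := CVG fk Lfk fkf.
have [U' [V' [Uk' Vh U'cvg]]] := Ph fk Lfk fkf.
apply: (eq_primitive_of ab _ Vh) => x xab.
apply/eqP; rewrite -subr_eq0 -normr_le0; apply/ler_addgt0Pl => e e0; rewrite addr0.
have e2 : 0 < e / 2 by rewrite divr_gt0.
have [N1 H1] := Ucvg _ e2; have [N2 H2] := U'cvg _ e2.
have {H1} := H1 (maxn N1 N2) (leq_maxl _ _) x xab.
have {H2} := H2 (maxn N1 N2) (leq_maxr _ _) x xab.
rewrite (primitive_unique ab (Uk' _) (Uk _) xab) distrC => H2 H1.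
set u := U _ x in H1 H2.
rewrite (_ : V' x - _ = (V' x - u) + (u - rlfrac a b p F x)); last by ring.
by rewrite (le_trans (ler_normD _ _))//; lra.
Qed.

(** The orders satisfy (m - p) + (p + q) = m + q, and [Dn m] removes m. The spare order q gives the
    conclusion the shape of the hypothesis, so that derivatives can be chained. *)
Lemma RLder_RLint F f p q : 0 <= p -> 0 <= q -> C0 a b F ->
  primitive_of a b (rlfrac a b (p + q) F) f ->
  primitive_of a b (rlfrac a b q F) (RLder a b p f).
Proof.
move=> p0 q0 CF Ff; rewrite /RLder; set m := `|Num.ceil p|%N.
have pm : p <= m%:R.
  rewrite /m natr_absz ger0_norm ?ceil_ge0 ?(lt_le_trans _ p0) ?ltrN10//.
  exact: ceil_ge.
have mp0 : 0 <= m%:R - p by rewrite subr_ge0.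
apply: (primitive_of_Dn ab q0 CF).
apply: (eq_primitive_of ab _ (primitive_of_RLint mp0 Ff)) => x xab.
have pq0 := addr_ge0 p0 q0.
by rewrite (rlfrac_comp ab mp0 pq0 CF xab) addrA subrK.
Qed.

End fractional_integral.

Theorem theorem4p9 (R : realType) (a b : R) (hab : a < b) (n1 n2 : R)
  (hn1 : 0 <= n1) (hn2 : 0 <= n2) (g : distr) (hg : HK a b g) :
  deq a b (RLder a b n1 (RLder a b n2 (RLint a b (n1 + n2) g)))
          (RLder a b (n1 + n2) (RLint a b (n1 + n2) g)).
Proof.
have [G Gg] := hg; have CG := Gg.1.
have n12 : 0 <= n1 + n2 by exact: addr_ge0.
have Jg := primitive_of_RLint hab n12 Gg.
have lhs : primitive_of a b (rlfrac a b 0 G)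
    (RLder a b n1 (RLder a b n2 (RLint a b (n1 + n2) g))).
  (* The outer derivative is removed with spare order 0, the inner one with spare order [n1]. *)
  apply: (RLder_RLint hab hn1 (lexx 0) CG); rewrite addr0.
  by apply: (RLder_RLint hab hn2 hn1 CG); rewrite [n2 + n1]addrC.
have rhs : primitive_of a b (rlfrac a b 0 G) (RLder a b (n1 + n2) (RLint a b (n1 + n2) g)).
  by apply: (RLder_RLint hab n12 (lexx 0) CG); rewrite addr0.
exact: primitive_of_deq lhs rhs.
Qed.
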